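(* Let $0<\alpha\le1$ and $\cos^{-1}\frac{\alpha}{2}\le\theta<\pi$, and let $T_{\alpha,\theta}\subset\mathbb{R}^2$ be the triangle with vertices $O(0,0)$, $A(1,0)$, $B(\alpha\cos\theta,\alpha\sin\theta)$. With the constants $C_J(\alpha,\theta)$ defined in the context, $$C_4(\alpha,\theta)\le C_0(\alpha,\theta),\qquad C_5(\alpha,\theta)\le C_0(\alpha,\theta)\,C_{\{1,2,3\}}(\alpha,\theta)\le C_0(\alpha,\theta)\,C_{\{1,2\}}(\alpha,\theta).$$
   Context: The edges of $T_{\alpha,\theta}$ are $e_1=OA$, $e_2=OB$, $e_3=AB$. $\|v\|$ is the $L_2(T_{\alpha,\theta})$ norm and $|v|_k$ is the standard $H^k(T_{\alpha,\theta})$ semi-norm: $|v|_1^2=\sum_i\|\partial_iv\|^2$, $|v|_2^2=\sum_{i,j=1}^2\|\partial_i\partial_jv\|^2$. Define $$V^0=\Big\{v\in H^1(T_{\alpha,\theta}):\int_{T_{\alpha,\theta}}v\,dx=0\Big\},\quad V^{\{1,2\}}=\Big\{v\in H^1(T_{\alpha,\theta}):\int_{e_1}v\,ds=\int_{e_2}v\,ds=0\Big\},$$ $$V^{\{1,2,3\}}=\Big\{v\in H^1(T_{\alpha,\theta}):\int_{e_i}v\,ds=0,\ i=1,2,3\Big\},\quad V^4=\Big\{v\in H^2(T_{\alpha,\theta}):\int_{e_i}v\,ds=0,\ i=1,2,3\Big\},$$ $$C_J(\alpha,\theta)=\sup_{v\in V^J\setminus\{0\}}\frac{\|v\|}{|v|_1}\quad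 (J=0,\{1,2\},\{1,2,3\}),$$ $$C_4(\alpha,\theta)=\sup_{v\in V^4\setminus\{0\}}\frac{|v|_1}{|v|_2},\qquad C_5(\alpha,\theta)=\sup_{v\in V^4\setminus\{0\}}\frac{\|v\|}{|v|_2}.$$ *)

(* Defs.v *)
From HB Require Import structures.
From mathcomp Require Import all_boot all_order all_algebra.
From mathcomp Require Import all_classical all_reals all_analysis.

Set Implicit Arguments.
Unset Strict Implicit.
Unset Printing Implicit Defensive.
Import Order.TTheory GRing.Theory Num.Theory.
Import numFieldNormedType.Exports.

Local Open Scope classical_set_scope.
Local Open Scope ring_scope.

Section plane.
Context {R : realType}.
Local Notation plane := (R * R)%type.
Local Notation leb := (@lebesgue_measure R).

Local Notation leb2 := (leb \x leb)%E.

Definition unit_vec (i : 'I_2) : plane := ((i == 0)%:R, (i == 1)%:R).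

Definition pderiv (i : 'I_2) (f : plane -> R) : plane -> R :=
  fun x => 'D_(unit_vec i) f x.

(* C^k functions on the whole plane *)
Fixpoint class_C (k : nat) (f : plane -> R) : Prop :=
  continuous f /\
  if k is k'.+1 then
    forall i, (forall x, derivable f x (unit_vec i)) /\ class_C k' (pderiv i f)
  else True.

Definition smooth (f : plane -> R) : Prop := forall k, class_C k f.

Definition test_function (Om : set plane) (phi : plane -> R) : Prop :=
  [/\ smooth phi, compact (closure [set x | phi x != 0])
    & closure [set x | phi x != 0] `<=` Om].

(* Functions on Om are represented by functions on the whole plane, whose values
   outside Om are never used: f \_ Om is the extension of f|Om by zero. *)
Definition L2 (Om : set plane) (f : plane -> R) : Prop :=
  f \_ Om \in Lfun leb2 2%:E.

Definition L2norm (Om : set plane) (f : plane -> R) : \bar R :=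
  'N[leb2]_(2%:E)[EFin \o (f \_ Om)]%E.

Definition is_weak_deriv (Om : set plane) (i : 'I_2) (v w : plane -> R) : Prop :=
  forall phi, test_function Om phi ->
    (\int[leb2]_(x in Om) (v x * pderiv i phi x) =
     - \int[leb2]_(x in Om) (w x * phi x))%R.

(* The weak derivative is only determined up to a null set; [wderiv] picks a
   square-integrable representative (and is the constant 0 if there is none). *)
Definition wderiv (Om : set plane) (i : 'I_2) (v : plane -> R) : plane -> R :=
  xget (cst 0) [set w | L2 Om w /\ is_weak_deriv Om i v w].

Definition H1 (Om : set plane) (v : plane -> R) : Prop :=
  L2 Om v /\ forall i, exists w, L2 Om w /\ is_weak_deriv Om i v w.

Definition H2 (Om : set plane) (v : plane -> R) : Prop :=
  H1 Om v /\ forall i, H1 Om (wderiv Om i v).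

Definition seminorm1 (Om : set plane) (v : plane -> R) : \bar R :=
  sqrte (\sum_(i < 2) L2norm Om (wderiv Om i v) ^+ 2)%E.

Definition seminorm2 (Om : set plane) (v : plane -> R) : \bar R :=
  sqrte (\sum_(i < 2) \sum_(j < 2)
           L2norm Om (wderiv Om i (wderiv Om j v)) ^+ 2)%E.

(* An edge is given by its two end points. *)
Definition edge_length (e : plane * plane) : R :=
  Num.sqrt ((e.2.1 - e.1.1) ^+ 2 + (e.2.2 - e.1.2) ^+ 2).

Definition edge_point (e : plane * plane) (t : R) : plane :=
  (1 - t) *: e.1 + t *: e.2.

Definition edge_integral (e : plane * plane) (g : plane -> R) : R :=
  edge_length e * \int[leb]_(t in `[0, 1]) g (edge_point e t).

Definition edge_L2 (e : plane * plane) (g : plane -> R) : Prop :=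
  (g \o edge_point e) \_ `[0%R, 1%R] \in Lfun leb 2%:E.

Definition edge_L2norm (e : plane * plane) (g : plane -> R) : \bar R :=
  ((Num.sqrt (edge_length e))%:E *
   'N[leb]_(2%:E)[EFin \o ((g \o edge_point e) \_ `[0%R, 1%R])])%E.

(* g is the trace of v on the edge e of Om: the trace operator is the continuous
   extension H^1(Om) -> L_2(e) of the restriction to e of functions that are
   smooth up to the boundary.  On a triangle every v in H^1 has exactly one
   trace on each edge (up to a null set of the edge). *)
Definition is_trace (Om : set plane) (e : plane * plane) (v g : plane -> R) :
    Prop :=
  edge_L2 e g /\
  exists phi : nat -> plane -> R,
    [/\ forall n, smooth (phi n),
        L2norm Om (phi n \- v) @[n --> \oo] --> 0%E,
        forall i,
          L2norm Om (pderiv i (phi n) \- wderiv Om i v) @[n --> \oo] --> 0%E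
      & edge_L2norm e (phi n \- g) @[n --> \oo] --> 0%E].

(* \int_e v ds = 0, the integrand being the trace of v on e *)
Definition edge_mean_zero (Om : set plane) (e : plane * plane) (v : plane -> R) :
    Prop :=
  exists g, is_trace Om e v g /\ edge_integral e g = 0.

Definition vertexO : plane := (0, 0).
Definition vertexA : plane := (1, 0).
Definition vertexB (alpha theta : R) : plane :=
  (alpha * cos theta, alpha * sin theta).

(* the open triangle OAB *)
Definition triangle (alpha theta : R) : set plane :=
  [set x | exists a b c : R, [/\ 0 < a, 0 < b, 0 < c, a + b + c = 1
     & x = a *: vertexO + b *: vertexA + c *: vertexB alpha theta]].

Definition edge1 : plane * plane := (vertexO, vertexA).
Definition edge2 (alpha theta : R) : plane * plane :=
  (vertexO, vertexB alpha theta).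
Definition edge3 (alpha theta : R) : plane * plane :=
  (vertexA, vertexB alpha theta).

Definition V0 (alpha theta : R) : set (plane -> R) :=
  [set v | H1 (triangle alpha theta) v /\
           (\int[leb2]_(x in triangle alpha theta) v x)%R = 0].

Definition Vedges (alpha theta : R) (J : set (plane * plane)) :
    set (plane -> R) :=
  [set v | H1 (triangle alpha theta) v /\
           forall e, J e -> edge_mean_zero (triangle alpha theta) e v].

Definition V12 (alpha theta : R) : set (plane -> R) :=
  Vedges alpha theta [set edge1; edge2 alpha theta].

Definition V123 (alpha theta : R) : set (plane -> R) :=
  Vedges alpha theta [set edge1; edge2 alpha theta; edge3 alpha theta].

Definition V4 (alpha theta : R) : set (plane -> R) :=
  [set v | H2 (triangle alpha theta) v /\
     forall e, [set edge1; edge2 alpha theta; edge3 alpha theta] e ->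
       edge_mean_zero (triangle alpha theta) e v].

(* Supremum of N v / D v over the v in V that are not zero almost everywhere on
   Om, in the extended reals, where x / 0 = +oo for x > 0. *)
Definition sup_ratio (Om : set plane) (V : set (plane -> R))
    (N D : (plane -> R) -> \bar R) : \bar R :=
  ereal_sup [set (N v / D v)%E | v in V `&` [set v | ~ ae_eq leb2 Om v (cst 0)]].

Definition C0 (alpha theta : R) : \bar R :=
  let T := triangle alpha theta in
  sup_ratio T (V0 alpha theta) (L2norm T) (seminorm1 T).

Definition C12 (alpha theta : R) : \bar R :=
  let T := triangle alpha theta in
  sup_ratio T (V12 alpha theta) (L2norm T) (seminorm1 T).

Definition C123 (alpha theta : R) : \bar R :=
  let T := triangle alpha theta in
  sup_ratio T (V123 alpha theta) (L2norm T) (seminorm1 T).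

Definition C4 (alpha theta : R) : \bar R :=
  let T := triangle alpha theta in
  sup_ratio T (V4 alpha theta) (seminorm1 T) (seminorm2 T).

Definition C5 (alpha theta : R) : \bar R :=
  let T := triangle alpha theta in
  sup_ratio T (V4 alpha theta) (L2norm T) (seminorm2 T).

End plane.

(* Main.v *)
From HB Require Import structures.
Require Import Defs.
From mathcomp Require Import all_boot all_order all_algebra.
From mathcomp Require Import all_classical all_reals all_analysis.
From mathcomp Require Import measurable_realfun ring lra.
Import Order.TTheory GRing.Theory Num.Theory.
Import numFieldNormedType.Exports.
Set Implicit Arguments.
Unset Strict Implicit.
Unset Printing Implicit Defensive.
Local Open Scope classical_set_scope.
Local Open Scope ring_scope.

(** Let P be a vertex of the triangle T and e the opposite edge. The field
    x - P is tangent to the two edges through P and has constant normal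
    component on e, so for every C^1 function f the divergence theorem gives
    [\int_T (2 f + (x - P) . grad f) = c \int_e f] with c > 0.  For v in V^4 the
    right-hand side vanishes for the trace of v, and since each instance involves
    a single edge one can pass to the limit along the sequence that defines the
    trace on that edge: no trace theorem is needed. Subtracting the three
    identities gives [(P - Q) . \int_T grad v = 0] for any two vertices P, Q,
    hence both partial derivatives of v have mean value 0, that is, they belong
    to V^0.  Applying the definition of C_0 to them gives
    [|v|_1 <= C_0 |v|_2]; the other bounds follow from [V^4 <= V^{1,2,3}] and
    [V^{1,2,3} <= V^{1,2}].  Since a supremum over the empty set is -oo, the
    products also require C_0 > 0; this is witnessed by the first coordinate
    minus its mean. *)

(** * Continuously differentiable functions on the plane *)

Section C1_functions.
Context {R : realType}.
Local Notation plane := (R * R)%type.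
Implicit Types (f : plane -> R).

(** The two end points come in either order, so that increments of any sign are covered; the case
    [b <= a] is the usual theorem read backwards. *)
Lemma MVT_signed (f df : R -> R) (a b : R) :
  (forall x : R, is_derive x 1 f (df x)) ->
  exists2 c, `|c - a| <= `|b - a| & f b - f a = df c * (b - a).
Proof.
move=> fdf.
have cf : continuous f.
  by move=> x; apply/differentiable_continuous/derivable1_diffP; have [] := fdf x.
have [ab|/ltW ba] := leP a b.
  have [|c /[!in_itv]/= /andP[ac cb] ->] := @MVT_segment _ f df a b ab (fun x _ => fdf x).
    exact: continuous_subspaceT.
  by exists c => //; rewrite !ger0_norm ?subr_ge0 ?lerB.
have [|c /[!in_itv]/= /andP[bc ca] E] := @MVT_segment _ f df b a ba (fun x _ => fdf x).
  exact: continuous_subspaceT.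
exists c; last by rewrite -opprB E -mulrN opprB.
by rewrite !ler0_norm ?subr_le0// !opprB lerB.
Qed.

(** The difference quotients agree as functions of [h], so both derivability and the value of the
    derivative carry over to the one-variable section. *)
Lemma derive_unit_vec0 f (x : plane) :
  (fun h : R => h^-1 *: ((f \o shift x) (h *: unit_vec 0) - f x)) =
  (fun h : R => h^-1 *: (((fun s => f (s, x.2)) \o shift x.1) (h *: (1:R)) - f (x.1, x.2))).
Proof.
apply/funext => h; case: x => a b /=; congr (_ *: (f _ - _)).
by rewrite -[LHS]/(h * 1 + a, h * 0 + b) mulr0 add0r.
Qed.

Lemma derive_unit_vec1 f (x : plane) :
  (fun h : R => h^-1 *: ((f \o shift x) (h *: unit_vec 1) - f x)) =
  (fun h : R => h^-1 *: (((fun s => f (x.1, s)) \o shift x.2) (h *: (1:R)) - f (x.1, x.2))).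
Proof.
apply/funext => h; case: x => a b /=; congr (_ *: (f _ - _)).
by rewrite -[LHS]/(h * 0 + a, h * 1 + b) mulr0 add0r.
Qed.

Lemma is_derive_pderiv0 f (a b : R) : derivable f (a, b) (unit_vec 0) ->
  is_derive a 1 (fun s => f (s, b)) (pderiv 0 f (a, b)).
Proof.
rewrite /derivable derive_unit_vec0/= => df.
apply: DeriveDef; first exact: df.
by rewrite /pderiv /derive derive_unit_vec0.
Qed.

Lemma is_derive_pderiv1 f (a b : R) : derivable f (a, b) (unit_vec 1) ->
  is_derive b 1 (fun s => f (a, s)) (pderiv 1 f (a, b)).
Proof.
rewrite /derivable derive_unit_vec1/= => df.
apply: DeriveDef; first exact: df.
by rewrite /pderiv /derive derive_unit_vec1.
Qed.

Definition C1 f := forall i, (forall x : plane, derivable f x (unit_vec i)) /\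
  continuous (pderiv i f).

Lemma class_C1 f : class_C 1 f -> C1 f.
Proof. by move=> [_ df] i; have [? []] := df i. Qed.

(** The increment is split at the corner [(a, b + k)], and the mean value theorem is applied on each
    leg. *)
Lemma C1_increment f (a b h k : R) : C1 f -> exists c1 c2,
  [/\ `|c1 - a| <= `|h|, `|c2 - b| <= `|k| &
   f (a + h, b + k) - f (a, b) =
   h * pderiv 0 f (c1, b + k) + k * pderiv 1 f (a, c2)].
Proof.
move=> C1f.
have [c1] := @MVT_signed (fun s => f (s, b + k)) (fun s => pderiv 0 f (s, b + k)) a (a + h)
     (fun s => is_derive_pderiv0 ((C1f 0).1 _)).
have [c2] := @MVT_signed (fun s => f (a, s)) (fun s => pderiv 1 f (a, s)) b (b + k)
     (fun s => is_derive_pderiv1 ((C1f 1).1 _)).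
rewrite (addrAC b) (addrAC a) !subrr !add0r => c2b E2 c1a E1.
exists c1, c2; split=> //.
by rewrite mulrC -E1 mulrC -E2 addrA subrK.
Qed.

(** Continuous partial derivatives give a total differential; this is what makes the chain rule
    available along slanted lines. *)
Lemma C1_differentiable f (x : plane) : C1 f -> differentiable f x /\
  (forall u w, 'd f x (u, w) = u * pderiv 0 f x + w * pderiv 1 f x).
Proof.
move=> C1f.
set fx := pderiv 0 f x; set fy := pderiv 1 f x.
pose d (h : plane) : R := h.1 * fx + h.2 * fy.
have lin_d : linear d.
  move=> k [a b] [a' b'].
  rewrite -[LHS]/((k * a + a') * fx + (k * b + b') * fy).
  rewrite -[RHS]/(k * (a * fx + b * fy) + (a' * fx + b' * fy)).
  by clear d; move: fx fy => fx fy; ring.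
pose dM := GRing.isLinear.Build _ _ _ _ _ lin_d.
pose dL : {linear plane -> R} := HB.pack d dM.
have cd : continuous dL.
  move=> h; apply: cvgD; apply: cvgMl; [exact: cvg_fst|exact: cvg_snd].
have E : f \o shift x = cst (f x) + dL +o_ (0 : plane) id.
  apply/eqaddoP => e e0.
  have [_ c0] := C1f 0; have [_ c1] := C1f 1.
  (* Each partial derivative receives half of the tolerance, and the max norm of the product bounds
     both [h.1] and [h.2]. *)
  have e20 : 0 < e / 2 by rewrite divr_gt0.
  have /cvgrPdist_le/(_ _ e20)/nbhs_ballP[d0 d00 H0] := c0 x.
  have /cvgrPdist_le/(_ _ e20)/nbhs_ballP[d1 d10 H1] := c1 x.
  near=> h.
  have hd0 : `|h| < d0 by near: h; exact: (@nbhs0_lt R (R * R)%type).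
  have hd1 : `|h| < d1 by near: h; exact: (@nbhs0_lt R (R * R)%type).
  have [c1' [c2']] := C1_increment x.1 x.2 h.1 h.2 C1f.
  move: hd0 hd1; rewrite prod_normE/= !gt_max => /andP[h1d0 h2d0] /andP[h1d1 h2d1].
  case=> c1x c2x; rewrite -surjective_pairing => E.
  have -> : (f \o (id + cst x) - (cst (f x) + d)) h =
      h.1 * (pderiv 0 f (c1', x.2 + h.2) - fx) +
      h.2 * (pderiv 1 f (x.1, c2') - fy).
    rewrite [LHS](_ : _ = f (x.1 + h.1, x.2 + h.2) - f x - (h.1 * fx + h.2 * fy)).
      by rewrite E !mulrBr opprD addrACA.
    rewrite -[LHS]/(f (h + x) - (f x + (h.1 * fx + h.2 * fy))) opprD addrA.
    by rewrite (addrC h x).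
  have b0 : `|pderiv 0 f (c1', x.2 + h.2) - fx| <= e / 2.
    rewrite distrC; apply: H0; split => /=.
      by rewrite -ball_normE /= distrC (le_lt_trans c1x).
    by rewrite -ball_normE /= opprD addrA subrr sub0r normrN.
  have b1 : `|pderiv 1 f (x.1, c2') - fy| <= e / 2.
    rewrite distrC; apply: H1; split => /=.
      exact: ballxx.
    by rewrite -ball_normE /= distrC (le_lt_trans c2x).
  move: (pderiv 0 f _ - fx) (pderiv 1 f _ - fy) b0 b1 => p0 p1 b0 b1.
  rewrite (le_trans (ler_normD _ _))// !normrM [e]splitr mulrDl lerD//.
    by rewrite mulrC ler_pM// le_max lexx.
  by rewrite mulrC ler_pM// le_max lexx orbT.
split.
  by apply/diff_locallyP; rewrite (diff_unique cd E).
by move=> u w; rewrite (diff_unique cd E).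
Unshelve. all: end_near. Qed.

Lemma C1_continuous f : C1 f -> continuous f.
Proof. by move=> C1f x; apply: differentiable_continuous; have [] := C1_differentiable x C1f. Qed.

Lemma is_derive_line f (a b u w t : R) : C1 f ->
  is_derive t 1 (fun t => f (a + t * u, b + t * w))
    (u * pderiv 0 f (a + t * u, b + t * w) + w * pderiv 1 f (a + t * u, b + t * w)).
Proof.
move=> C1f.
have aff (c v : R) : is_derive t (1 : R) (fun t : R => c + t * v) v.
  have -> : (fun t : R => c + t * v) = cst c + v \*: id.
    by apply/funext => r; rewrite mulrC.
  by apply: is_derive_eq; rewrite add0r scaler1.
have daff (c v : R) : differentiable (fun t : R => c + t * v) t.
  by apply/derivable1_diffP; have [] := aff c v.
have affE (c v : R) : 'd (fun t : R => c + t * v) t (1 : R) = v.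
  by rewrite -(deriveE (1 : R) (daff c v)); have [] := aff c v.
have dg : differentiable (fun t : R => (a + t * u, b + t * w) : plane) t.
  exact: differentiable_pair (daff _ _) (daff _ _).
have [df dfE] := C1_differentiable (a + t * u, b + t * w) C1f.
have dfg : differentiable (f \o (fun t : R => (a + t * u, b + t * w))) t.
  exact: differentiable_comp.
apply: DeriveDef; first exact/derivable1_diffP.
rewrite (deriveE (1 : R) dfg) diff_comp//= diff_pair ?affE ?dfE//.
Qed.

Lemma pderivM i f g (x : plane) : C1 f -> C1 g ->
  pderiv i (fun x => f x * g x) x = f x * pderiv i g x + g x * pderiv i f x.
Proof.
move=> C1f C1g.
have := deriveM ((C1f i).1 x) ((C1g i).1 x).
by rewrite /pderiv.
Qed.

Lemma C1M f g : C1 f -> C1 g -> C1 (fun x => f x * g x).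
Proof.
move=> C1f C1g i; split=> [x|].
  by apply: (derivableM ((C1f i).1 x) ((C1g i).1 x)).
have -> : pderiv i (fun x => f x * g x) = f \* pderiv i g \+ g \* pderiv i f.
  by apply/funext => x; rewrite pderivM.
have [_ cf] := C1f i; have [_ cg] := C1g i.
move=> x; apply: cvgD; apply: cvgM.
- exact: C1_continuous.
- exact: cg.
- exact: C1_continuous.
- exact: cf.
Qed.

Lemma is_derive_fst i (c : R) (x : plane) :
  is_derive x (unit_vec i) (fun x : plane => x.1 - c) (i == 0)%:R.
Proof.
have [->|->] : i = 0 \/ i = 1.
  by case: i => -[|[|//]] i2; [left|right]; exact/val_inj.
- have [dd de] : is_derive x.1 (1 : R) (fun s => s - c) 1.
    have -> : (fun s => s - c) = id + cst (- c) by [].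
    by apply: is_derive_eq; rewrite subr0.
  apply: DeriveDef; first by rewrite /derivable derive_unit_vec0; exact: dd.
  by rewrite /derive derive_unit_vec0; exact: de.
- have [dd de] : is_derive x.2 (1 : R) (fun=> x.1 - c) 0 by exact: is_derive_cst.
  apply: DeriveDef; first by rewrite /derivable derive_unit_vec1; exact: dd.
  by rewrite /derive derive_unit_vec1; exact: de.
Qed.

Lemma C1_fst (c : R) : C1 (fun x : plane => x.1 - c).
Proof.
move=> i; split=> [x|]; first by have [] := is_derive_fst i c x.
have -> : pderiv i (fun x : plane => x.1 - c) = cst (i == 0)%:R.
  by apply/funext => x; have [_] := is_derive_fst i c x.
exact: cst_continuous.
Qed.

End C1_functions.

(** * Measurability of continuous functions on the plane *)

Section plane_measurability.
Context {R : realType}.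
Local Notation mR := (measurableTypeR R).

(** The plane carries the product sigma-algebra, so openness has to be reduced to rectangles: an
    open set is the countable union of the open rectangles with rational corners that it
    contains. *)
Lemma open_measurable_plane (A : set (R * R)) : open A ->
  measurable (A : set (mR * mR)).
Proof.
move=> oA.
pose Q (a b c d : rat) : set (mR * mR) :=
  `]ratr a : R, ratr b[%classic `*` `]ratr c : R, ratr d[%classic.
have -> : A = \bigcup_a \bigcup_b \bigcup_c \bigcup_d
    (if `[< Q a b c d `<=` A >] then Q a b c d else set0).
  apply/seteqP; split=> [[x y] Axy|[x y] [a _] [b _] [c _] [d _]]; last first.
    by case: asboolP => [QA Qxy|//]; exact: QA.
  move: oA; rewrite openE => /(_ _ Axy) /nbhs_ballP[e /= e0 xyeA].
  have e1 (z : R) : z - e < z by rewrite ltrBlDr ltrDl.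
  have e2 (z : R) : z < z + e by rewrite ltrDl.
  have [a /[!inE]/= /andP[xa ax]] := rat_in_itvoo (e1 x).
  have [b /[!inE]/= /andP[xb bx]] := rat_in_itvoo (e2 x).
  have [c /[!inE]/= /andP[yc cy]] := rat_in_itvoo (e1 y).
  have [d /[!inE]/= /andP[yd dy]] := rat_in_itvoo (e2 y).
  exists a => //; exists b => //; exists c => //; exists d => //.
  case: asboolP => [_|]; first by split; rewrite /= in_itv/=; apply/andP.
  case=> -[u v] [/=]; rewrite !in_itv/= => /andP[au ub] /andP[cv vd].
  move: xa ax xb bx yc cy yd dy; rewrite !bnd_simp => xa ax xb bx yc cy yd dy.
  apply: xyeA; split; rewrite -ball_normE /= ltr_distl; apply/andP; split.
  - by rewrite ltrBlDr (lt_trans ub bx).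
  - by rewrite -ltrBlDr (lt_trans xa au).
  - by rewrite ltrBlDr (lt_trans vd dy).
  - by rewrite -ltrBlDr (lt_trans yc cv).
do 4 (apply: bigcupT_measurable_rat => ?).
case: ifPn => _; last exact: measurable0.
by apply: measurableX; exact: measurable_itv.
Qed.

Lemma continuous_measurable_plane (f : R * R -> R) : continuous f ->
  measurable_fun [set: mR * mR] f.
Proof.
move=> /continuousP cf.
apply: (measurability _ (RGenOpens.measurableE R)) => //.
move=> _ [_ [a [b ->] <-]]; rewrite setTI.
by apply: open_measurable_plane; apply: cf; exact: interval_open.
Qed.

End plane_measurability.

(** * Square-integrability and the L2 norm *)

Section L2_functions.
Context d (T : measurableType d) {R : realType} (mu : {measure set T -> \bar R}).
Implicit Types f g : T -> R.

Lemma Lnorm2_sqr f : ('N[mu]_2%:E[EFin \o f] `^ 2 = \int[mu]_x ((f x) ^+ 2)%:E)%E.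
Proof.
rewrite powR_Lnorm//; apply: eq_integral => x _ /=.
by rewrite powR_mulrn// -normrX ger0_norm ?sqr_ge0.
Qed.

Lemma Lfun2_sqr_integrable f : measurable_fun setT f ->
  mu.-integrable setT (fun x => ((f x) ^+ 2)%:E) -> f \in Lfun mu 2%:E.
Proof.
move=> mf /integrableP[_ fi]; rewrite inE; apply/andP; split; rewrite inE//=.
apply: (@lty_poweRy _ _ 2) => //; rewrite Lnorm2_sqr; apply: le_lt_trans fi.
by under [leRHS]eq_integral do rewrite gee0_abs ?lee_fin ?sqr_ge0//.
Qed.

End L2_functions.

(** * Continuous functions on bounded planar sets, Fubini and the fundamental theorem on
    rectangles *)

Section bounded_planar_sets.
Context {R : realType}.
Local Notation mR := (measurableTypeR R).
Local Notation leb := (@lebesgue_measure R).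
Local Notation leb2 := (leb \x leb)%E.
Implicit Types (F G : R * R -> R) (D : set (mR * mR)).

Definition box (r : R) : set (mR * mR) :=
  `[- r, r]%classic `*` `[- r, r]%classic.

Lemma box_bounded F r : continuous F -> exists M : R, forall p, box r p -> `|F p| <= M.
Proof.
(* For negative [r] the box is empty, whereas the extreme value theorem asks for a point. *)
move=> cF; have [[p0 bp0]|b0] := pselect (exists p, box r p); last first.
  by exists 0 => p bp; case: b0; exists p.
have [|||p _ pM] := @compact_EVT_max (R * R)%type R (fun p => `|F p|) (box r).
- by exists p0.
- by apply: compact_setX; exact: segment_compact.
- apply: continuous_subspaceT => x; apply: (continuous_comp (cF x)).
  exact: norm_continuous.
by exists `|F p| => q bq; apply: pM; rewrite inE.
Qed.

(** The domains on which every continuous function is both integrable and square-integrable. *)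
Definition bounded_measurable D := measurable D /\ exists r, D `<=` box r.

Lemma bounded_measurable_lty D : bounded_measurable D -> (leb2 D < +oo)%E.
Proof.
move=> [mD [r Dr]]; apply: (@le_lt_trans _ _ (leb2 (box r))).
  rewrite le_measure ?inE//.
  by apply: measurableX; exact: measurable_itv.
rewrite product_measure1E; try exact: measurable_itv.
have lty : (leb `[(- r)%R, r] < +oo)%E.
  by rewrite lebesgue_measure_itv/=; case: ifP => _; rewrite ltry.
by rewrite lte_mul_pinfty// ge0_fin_numE.
Qed.

Lemma continuous_bounded_integrable D F : bounded_measurable D -> continuous F ->
  leb2.-integrable D (EFin \o F).
Proof.
move=> bD cF; apply: measurable_bounded_integrable.
- by case: bD.
- exact: bounded_measurable_lty.
- by apply: measurable_funTS; exact: continuous_measurable_plane.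
- have [_ [r Dr]] := bD; have [M FM] := box_bounded r cF.
  exists M; split; first exact: num_real.
  by move=> N MN p Dp; rewrite /= (le_trans (FM _ (Dr _ Dp)))// ltW.
Qed.

Lemma continuous_restrict_integrable D F : bounded_measurable D -> continuous F ->
  leb2.-integrable setT (EFin \o (F \_ D)).
Proof.
move=> bD cF; rewrite -restrict_EFin.
apply/(integrable_mkcond _ _).1; first by case: bD.
exact: continuous_bounded_integrable.
Qed.

Lemma continuous_L2 D F : bounded_measurable D -> continuous F -> L2 D F.
Proof.
move=> bD cF; have [mD _] := bD.
apply: Lfun2_sqr_integrable.
  apply/(measurable_restrictT _ _).1 => //.
  by apply: measurable_funTS; exact: continuous_measurable_plane.
have -> : (fun x => (((F \_ D) x) ^+ 2)%:E) = (EFin \o (fun p => F p ^+ 2)) \_ D.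
  by apply/funext => p; rewrite !patchE; case: ifP => //= _; rewrite expr0n.
apply/(integrable_mkcond _ _).1 => //.
apply: continuous_bounded_integrable => // x.
by rewrite (_ : (fun _ => _) = F \* F)//; apply: cvgM; exact: cF.
Qed.

(** The integrand is extended by zero, so Fubini on the whole plane applies and the shape of [D]
    only enters through its sections. *)
Lemma integral_bounded_fubini D F : bounded_measurable D -> continuous F ->
  (\int[leb2]_(p in D) (F p)%:E = \int[leb]_x \int[leb]_y ((F \_ D) (x, y))%:E)%E /\
  (\int[leb2]_(p in D) (F p)%:E = \int[leb]_y \int[leb]_x ((F \_ D) (x, y))%:E)%E.
Proof.
move=> bD cF.
have iF := continuous_restrict_integrable bD cF.
have -> : (\int[leb2]_(p in D) (F p)%:E = \int[leb2]_p (EFin \o (F \_ D)) p)%E.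
  by rewrite integral_mkcond -restrict_EFin.
by split; [exact: (esym (integral12_prod_meas1 iF))|exact: (esym (integral21_prod_meas1 iF))].
Qed.

Lemma continuous_itv_integrable (h : R -> R) (a b : R) : continuous h ->
  leb.-integrable `[a, b] (EFin \o h).
Proof.
move=> ch; apply: continuous_compact_integrable; first exact: segment_compact.
exact: continuous_subspaceT.
Qed.

Lemma EFin_Rintegral_itv (h : R -> R) (a b : R) : continuous h ->
  (\int[leb]_(x in `[a, b]) (h x)%:E)%E = (\int[leb]_(x in `[a, b]) h x)%:E.
Proof.
move=> ch; rewrite fineK//.
by apply: integrable_fin_num => //; exact: continuous_itv_integrable.
Qed.

Lemma continuous_pair (T : topologicalType) F (u v : T -> R) : continuous F ->
  continuous u -> continuous v -> continuous (fun t => F (u t, v t)).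
Proof.
move=> cF cu cv t; apply: (@continuous_comp _ _ _ (fun t => (u t, v t)) F).
  exact: (@cvg_pair _ _ _ (nbhs t) (nbhs (u t)) (nbhs (v t)) _ _ _ u v (cu t) (cv t)).
exact: cF.
Qed.

Lemma continuous_row F (y : R) : continuous F -> continuous (fun x : R => F (x, y)).
Proof. by move=> cF; apply: continuous_pair => // x; [exact: cvg_id|exact: cvg_cst]. Qed.

Lemma continuous_col F (x : R) : continuous F -> continuous (fun y : R => F (x, y)).
Proof. by move=> cF; apply: continuous_pair => // y; [exact: cvg_cst|exact: cvg_id]. Qed.

Definition rect (a b : R) : set (mR * mR) := `[0, a]%classic `*` `[0, b]%classic.

Lemma bounded_measurable_rect a b : bounded_measurable (rect a b).
Proof.
split; first by apply: measurableX; exact: measurable_itv.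
exists (Num.max a b) => -[x y] [/=]; rewrite !in_itv/= => /andP[x0 xa] /andP[y0 yb].
have xm : x <= Num.max a b by rewrite le_max xa.
have ym : y <= Num.max a b by rewrite le_max yb orbT.
by split; rewrite /= in_itv/=; apply/andP; split => //;
  rewrite lerNl (le_trans _ (le_trans x0 xm))// oppr_le0.
Qed.

Lemma Rintegral_rect a b F : continuous F ->
  \int[leb2]_(p in rect a b) F p =
    \int[leb]_(x in `[0, a]) \int[leb]_(y in `[0, b]) F (x, y) /\
  \int[leb2]_(p in rect a b) F p =
    \int[leb]_(y in `[0, b]) \int[leb]_(x in `[0, a]) F (x, y).
Proof.
move=> cF.
have [E1 E2] := integral_bounded_fubini (bounded_measurable_rect a b) cF.
split; [rewrite [LHS]/Rintegral E1|rewrite [LHS]/Rintegral E2];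
  rewrite [RHS]Rintegral_mkcond; congr fine.
- apply: eq_integral => x _; rewrite patchE; case: ifPn => xa.
    rewrite -EFin_Rintegral_itv; last exact: continuous_col.
    rewrite [RHS]integral_mkcond; apply: eq_integral => y _.
    rewrite restrict_EFin/= !patchE; congr EFin; congr (if _ then _ else _).
    apply/idP/idP; rewrite !inE; first by case.
    by split=> //; exact: set_mem xa.
  rewrite integral0_eq// => y _; rewrite patchE ifF//; apply/negbTE.
  by apply: contra xa; rewrite !inE => -[].
- apply: eq_integral => y _; rewrite patchE; case: ifPn => yb.
    rewrite -EFin_Rintegral_itv; last exact: continuous_row.
    rewrite [RHS]integral_mkcond; apply: eq_integral => x _.
    rewrite restrict_EFin/= !patchE; congr EFin; congr (if _ then _ else _).
    apply/idP/idP; rewrite !inE; first by case.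
    by split=> //; exact: set_mem yb.
  rewrite integral0_eq// => x _; rewrite patchE ifF//; apply/negbTE.
  by apply: contra yb; rewrite !inE => -[].
Qed.

Lemma Rintegral_FTC (G dG : R -> R) (a b : R) : a < b ->
  (forall x : R, is_derive x 1 G (dG x)) -> continuous dG ->
  \int[leb]_(x in `[a, b]) dG x = G b - G a.
Proof.
move=> ab GdG cdG.
have cG : continuous G.
  by move=> x; apply/differentiable_continuous/derivable1_diffP; have [] := GdG x.
rewrite /Rintegral (@continuous_FTC2 _ _ G)//.
- exact: continuous_subspaceT.
- split; first by move=> x _; have [] := GdG x.
    exact/cvg_at_right_filter/cG.
  exact/cvg_at_left_filter/cG.
- by move=> x _; rewrite derive1E; have [] := GdG x.
Qed.

(** Taking the inner integral in the variable of differentiation leaves boundary terms on two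
    opposite sides only. *)
Lemma Rintegral_rect_FTC1 a b G dG : 0 < a -> continuous dG ->
  (forall x y : R, is_derive x 1 (fun x => G (x, y)) (dG (x, y))) ->
  \int[leb2]_(p in rect a b) dG p = \int[leb]_(y in `[0, b]) (G (a, y) - G (0, y)).
Proof.
move=> a0 cdG GdG; have [_ ->] := Rintegral_rect a b cdG.
apply: eq_Rintegral => y _; rewrite (@Rintegral_FTC (fun x => G (x, y)))//.
exact: continuous_row.
Qed.

Lemma Rintegral_rect_FTC2 a b G dG : 0 < b -> continuous dG ->
  (forall x y : R, is_derive y 1 (fun y => G (x, y)) (dG (x, y))) ->
  \int[leb2]_(p in rect a b) dG p = \int[leb]_(x in `[0, a]) (G (x, b) - G (x, 0)).
Proof.
move=> b0 cdG GdG; have [-> _] := Rintegral_rect a b cdG.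
apply: eq_Rintegral => x _; rewrite (@Rintegral_FTC (fun y => G (x, y)))//.
exact: continuous_col.
Qed.

End bounded_planar_sets.

(** * Integration over the triangle by a change of variables to a rectangle *)

Section triangle_integral.
Context {R : realType}.
Local Notation mR := (measurableTypeR R).
Local Notation leb := (@lebesgue_measure R).
Local Notation leb2 := (leb \x leb)%E.

Lemma is_derive_affine (c k t : R) : is_derive t 1 (fun t : R => c + k * t) k.
Proof.
have -> : (fun t : R => c + k * t) = cst c + k \*: id by [].
by apply: is_derive_eq; rewrite add0r scaler1.
Qed.

Lemma continuous_affine (c k : R) : continuous (fun t : R => c + k * t).
Proof.
move=> t; apply/differentiable_continuous/derivable1_diffP.
by have [] := is_derive_affine c k t.
Qed.

Lemma integral_affine (h : R -> R) (c k : R) : 0 < k -> continuous h ->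
  (\int[leb]_(x in `[c, (c + k)%R]) (h x)%:E =
   \int[leb]_(t in `[0%R, 1%R]) (k * h (c + k * t))%R%:E)%E.
Proof.
move=> k0 ch; pose A t : R := c + k * t.
have dA : derive1 A = cst k.
  by apply/funext => t; rewrite derive1E; have [] := is_derive_affine c k t.
have := @integration_by_substitution_increasing R A h 0 1.
rewrite /A mulr0 addr0 mulr1 -/A => ->//.
- by apply: eq_integral => t _; rewrite -[k * _]mulrC dA.
- by move=> x y _ _ xy; rewrite /A ltrD2l ltr_pM2l.
- by rewrite dA => ? _; exact: cst_continuous.
- by rewrite dA; exact: is_cvg_cst.
- by rewrite dA; exact: is_cvg_cst.
- split; first by move=> x _; have [] := is_derive_affine c k x.
    exact/cvg_at_right_filter/continuous_affine.
  exact/cvg_at_left_filter/continuous_affine.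
- exact: continuous_subspaceT.
Qed.


Section continuity.
Variables (T : topologicalType).
Implicit Types f g : T -> R.

Lemma continuous_add f g : continuous f -> continuous g -> continuous (fun x => f x + g x).
Proof. by move=> cf cg x; apply: cvgD; [exact: cf|exact: cg]. Qed.

Lemma continuous_mul f g : continuous f -> continuous g -> continuous (fun x => f x * g x).
Proof. by move=> cf cg x; apply: cvgM; [exact: cf|exact: cg]. Qed.

Lemma continuous_opp f : continuous f -> continuous (fun x => - f x).
Proof. by move=> cf x; apply: cvgN; exact: cf. Qed.

End continuity.

Lemma continuous_fst : continuous (fun p : R * R => p.1).
Proof. by move=> p; exact: cvg_fst. Qed.

Lemma continuous_snd : continuous (fun p : R * R => p.2).
Proof. by move=> p; exact: cvg_snd. Qed.

Lemma measurable_lt_plane (f g : R * R -> R) : continuous f -> continuous g ->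
  measurable ([set p | f p < g p] : set (mR * mR)).
Proof.
move=> cf cg.
have cgf : continuous (fun p => g p + - f p) by apply/continuous_add/continuous_opp.
have := continuous_measurable_plane cgf measurableT (measurable_itv `]0, +oo[).
rewrite setTI; congr measurable; apply/seteqP.
by split=> p; rewrite /= in_itv/= andbT subr_gt0.
Qed.

Variables b H : R.
Implicit Types (F : R * R -> R) (D : set (mR * mR)).
Hypothesis H_gt0 : 0 < H.

(* The open triangle with vertices (0, 0), (1, 0) and (b, H), as a union of horizontal
   segments; [triangleE] identifies it with the triangle of the statement. *)
Definition slab : set (mR * mR) := [set p | [/\ 0 < p.2, p.2 < H,
  b * (p.2 / H) < p.1 & p.1 < b * (p.2 / H) + (1 - p.2 / H)]].

(* Parametrizes the triangle by [0, 1] x [0, H], contracting the side y = H of the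
   rectangle to the vertex (b, H); the Jacobian is 1 - y / H. *)
Definition duffy (q : R * R) : R * R :=
  (b * (q.2 / H) + (1 - q.2 / H) * q.1, q.2).

Lemma continuous_duffy F : continuous F -> continuous (fun q => F (duffy q)).
Proof.
move=> cF; apply: continuous_pair => //; last exact: continuous_snd.
have c2 : continuous (fun q : R * R => q.2 / H).
  by apply: continuous_mul; [exact: continuous_snd|exact: cst_continuous].
apply: continuous_add; first by apply: continuous_mul => //; exact: cst_continuous.
apply: continuous_mul; last exact: continuous_fst.
by apply: continuous_add; [exact: cst_continuous|exact: continuous_opp].
Qed.

Lemma bounded_measurable_slab : bounded_measurable slab.
Proof.
have c2 : continuous (fun q : R * R => q.2 / H).
  by apply: continuous_mul; [exact: continuous_snd|exact: cst_continuous].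
have cl : continuous (fun q : R * R => b * (q.2 / H)).
  by apply: continuous_mul => //; exact: cst_continuous.
split.
  have -> : slab = [set p | 0 < p.2] `&` [set p | p.2 < H] `&`
     [set p | b * (p.2 / H) < p.1] `&` [set p | p.1 < b * (p.2 / H) + (1 - p.2 / H)].
    by apply/seteqP; split=> [p []//|p [[[]]]].
  apply: measurableI; first apply: measurableI; first apply: measurableI.
  - by apply: measurable_lt_plane; [exact: cst_continuous|exact: continuous_snd].
  - by apply: measurable_lt_plane; [exact: continuous_snd|exact: cst_continuous].
  - by apply: measurable_lt_plane => //; exact: continuous_fst.
  - apply: measurable_lt_plane; first exact: continuous_fst.
    apply: continuous_add => //.
    by apply: continuous_add; [exact: cst_continuous|exact: continuous_opp].
exists (`|b| + 1 + H) => -[x y] [/= y0 yH lx xr].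
have c0 : 0 < y / H by rewrite divr_gt0.
have c1 : y / H < 1 by rewrite ltr_pdivrMr// mul1r.
have bc : `|b * (y / H)| <= `|b|.
  by rewrite normrM ler_piMr// gtr0_norm// ltW.
have [bc1 bc2] : - `|b| <= b * (y / H) /\ b * (y / H) <= `|b|.
  by move: bc; rewrite ler_norml => /andP[].
by split; rewrite /= in_itv/=; apply/andP; split; lra.
Qed.

(** Fubini on both sides reduces the change of variables to one row: for fixed [y], [duffy] is
    affine in the first variable with slope [1 - y / H]. *)
Lemma Rintegral_slab F : continuous F ->
  \int[leb2]_(p in slab) F p =
  \int[leb2]_(q in rect 1 H) ((1 - q.2 / H) * F (duffy q)).
Proof.
move=> cF.
have cG : continuous (fun q : R * R => (1 - q.2 / H) * F (duffy q)).
  apply: continuous_mul; last exact: continuous_duffy.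
  apply: continuous_add; first exact: cst_continuous.
  apply/continuous_opp/continuous_mul; [exact: continuous_snd|exact: cst_continuous].
have [_ E1] := integral_bounded_fubini bounded_measurable_slab cF.
have [_ E2] := integral_bounded_fubini (bounded_measurable_rect 1 H) cG.
rewrite /Rintegral E1 E2; congr fine; apply: ae_eq_integral => //.
- exact: measurable_fubini_G (continuous_restrict_integrable bounded_measurable_slab cF).
- exact: measurable_fubini_G (continuous_restrict_integrable (bounded_measurable_rect 1 H) cG).
(* The rows are compared off the null set [y = 0], a row of the closed rectangle that the open
   triangle does not meet. *)
exists [set 0]; split; first exact: measurable_set1.
  exact: lebesgue_measure_set1.
move=> y /= nE; apply: contrapT => y0; apply: nE => _.
(* Outside [0 < y < H] both row integrals vanish; at [y = H] the one over the rectangle does because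
   its Jacobian factor is zero. *)
have [/andP[{}y0 yH]|yN] := boolP ((0 < y) && (y < H)); last first.
  rewrite !integral0_eq// => x _; rewrite patchE; case: ifP => //.
    move=> /set_mem[_ /=]; rewrite in_itv/= => /andP[y0' yH].
    have {}y0' : 0 < y by rewrite lt_neqAle y0' andbT eq_sym; apply/eqP.
    have -> : y = H by apply/eqP; rewrite eq_le yH leNgt; move: yN; rewrite y0'.
    by rewrite divff ?gt_eqF// subrr mul0r.
  by move=> /set_mem[/= y0' yH _ _]; move: yN; rewrite y0' yH.
have c1 : 0 < 1 - y / H by rewrite subr_gt0 ltr_pdivrMr// mul1r.
transitivity (\int[leb]_(x in `](b * (y / H))%R, (b * (y / H) + (1 - y / H))%R[) (F (x, y))%:E)%E.
  rewrite [RHS]integral_mkcond; apply: eq_integral => x _.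
  rewrite restrict_EFin/= !patchE; congr EFin; congr (if _ then _ else _).
  apply/idP/idP; rewrite !inE /= in_itv/=; first by case=> _ _ -> ->.
  by move=> /andP[? ?]; split.
(* The row of the open triangle is an open interval; adding its end points does not change the
   integral. *)
rewrite -(integral_itv_bndoo true false); last first.
  apply/measurable_EFinP; apply: measurable_funTS; apply: continuous_measurable_fun.
  exact: (@continuous_row _ F y cF).
rewrite (integral_affine _ c1 (@continuous_row _ F y cF)).
rewrite integral_mkcond; apply: eq_integral => x _.
rewrite restrict_EFin/= !patchE; congr EFin; congr (if _ then _ else _).
apply/idP/idP; rewrite !inE; last by case.
by split=> //; rewrite /= in_itv/= !ltW.
Qed.

End triangle_integral.

(** * The divergence theorem for the fields x - P, with P a vertex *)

Section gauss_green.
Context {R : realType}.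
Local Notation leb := (@lebesgue_measure R).
Local Notation leb2 := (leb \x leb)%E.

Lemma is_derive_mul (f g : R -> R) (x df dg : R) :
  is_derive x 1 f df -> is_derive x 1 g dg ->
  is_derive x 1 (fun y => f y * g y) (f x * dg + df * g x).
Proof.
move=> fdf gdg; have -> : (fun y => f y * g y) = f * g by [].
by apply: is_derive_eq; rewrite /GRing.scale/= (mulrC df).
Qed.

Lemma is_derive_scale (k x : R) (g : R -> R) (dg : R) :
  is_derive x 1 g dg -> is_derive x 1 (fun y => k * g y) (k * dg).
Proof.
by move=> gdg; apply: is_derive_eq (is_derive_mul (is_derive_cst k x 1) gdg) _;
  rewrite mul0r addr0.
Qed.

Variables (b H : R) (f : R * R -> R).
Hypotheses (H_gt0 : 0 < H) (C1f : C1 f).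
Local Notation duffy := (duffy b H).

Lemma is_derive_duffy_fst (t y : R) :
  is_derive t 1 (fun t => f (duffy (t, y)))
    ((1 - y / H) * pderiv 0 f (duffy (t, y))).
Proof.
have E (z : R) : duffy (z, y) = (b * (y / H) + z * (1 - y / H), y + z * 0).
  by rewrite /duffy/= mulr0 addr0 (mulrC z).
have -> : (fun t => f (duffy (t, y))) =
    (fun z => f (b * (y / H) + z * (1 - y / H), y + z * 0)).
  by apply/funext => z; rewrite E.
rewrite E; apply: is_derive_eq (is_derive_line _ _ _ _ _ C1f) _.
by rewrite mul0r addr0.
Qed.

(** For fixed [t] the map [duffy] runs along the straight line from [(t, 0)] to [(b, H)], with
    direction [((b - t) / H, 1)], so the chain rule along lines suffices. *)
Lemma is_derive_duffy_snd (t y : R) :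
  is_derive y 1 (fun y => f (duffy (t, y)))
    ((b - t) / H * pderiv 0 f (duffy (t, y)) + pderiv 1 f (duffy (t, y))).
Proof.
have E (z : R) : duffy (t, z) = (t + z * ((b - t) / H), 0 + z * 1).
  rewrite /duffy/=; congr pair; [field|ring].
  by rewrite gt_eqF.
have -> : (fun y => f (duffy (t, y))) =
    (fun z => f (t + z * ((b - t) / H), 0 + z * 1)).
  by apply/funext => z; rewrite E.
rewrite E; apply: is_derive_eq (is_derive_line _ _ _ _ _ C1f) _.
by rewrite mul1r.
Qed.

(* In the coordinates [duffy], the flux integrand for the apex P times the Jacobian is
   required to be a divergence on the rectangle, with primitives G1 and G2. *)
Lemma Rintegral_slab_flux (P : R * R) (G1 G2 dG1 dG2 : R * R -> R) :
  continuous dG1 -> continuous dG2 ->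
  (forall t y : R, is_derive t 1 (fun t => G1 (t, y)) (dG1 (t, y))) ->
  (forall t y : R, is_derive y 1 (fun y => G2 (t, y)) (dG2 (t, y))) ->
  (forall q : R * R, (1 - q.2 / H) * (2 * f (duffy q) +
      ((duffy q).1 - P.1) * pderiv 0 f (duffy q) +
      ((duffy q).2 - P.2) * pderiv 1 f (duffy q)) = dG1 q + dG2 q) ->
  \int[leb2]_(p in slab b H)
    (2 * f p + (p.1 - P.1) * pderiv 0 f p + (p.2 - P.2) * pderiv 1 f p) =
  \int[leb]_(y in `[0, H]) (G1 (1, y) - G1 (0, y)) +
  \int[leb]_(t in `[0, 1]) (G2 (t, H) - G2 (t, 0)).
Proof.
move=> cG1 cG2 GdG1 GdG2 E.
have cf := C1_continuous C1f.
have [_ c0] := C1f 0; have [_ c1] := C1f 1.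
rewrite Rintegral_slab//; last first.
  apply: continuous_add; first apply: continuous_add.
  - by apply: continuous_mul; [exact: cst_continuous|exact: cf].
  - apply: continuous_mul; last exact: c0.
    by apply: continuous_add; [exact: continuous_fst|exact: cst_continuous].
  - apply: continuous_mul; last exact: c1.
    by apply: continuous_add; [exact: continuous_snd|exact: cst_continuous].
under eq_Rintegral do rewrite E.
rewrite RintegralD.
- rewrite (Rintegral_rect_FTC1 _ ltr01 cG1 GdG1).
  by rewrite (Rintegral_rect_FTC2 _ H_gt0 cG2 GdG2).
- by have [] := bounded_measurable_rect 1 H.
- by apply: continuous_bounded_integrable => //; exact: bounded_measurable_rect.
- by apply: continuous_bounded_integrable => //; exact: bounded_measurable_rect.
Qed.

Lemma is_derive_height (y : R) : is_derive y 1 (fun y : R => 1 - y / H) (- H^-1).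
Proof.
have -> : (fun y : R => 1 - y / H) = (fun y => 1 + (- H^-1) * y).
  by apply/funext => z; rewrite mulNr mulrC.
exact: is_derive_affine.
Qed.

Let cs : continuous (fun q : R * R => 1 - q.2 / H).
Proof.
apply: continuous_add; first exact: cst_continuous.
by apply/continuous_opp/continuous_mul; [exact: continuous_snd|exact: cst_continuous].
Qed.

Let cf (g : R * R -> R) : continuous g -> continuous (fun q => g (duffy q)).
Proof. exact: continuous_duffy. Qed.

Let H0 : H != 0. Proof. by rewrite gt_eqF. Qed.

(** In these coordinates the field points along the lines [t] constant: with [s = 1 - y / H], the
    difference [duffy (t, y) - (b, H)] is [- H * s] times the direction [((b - t) / H, 1)]. Hence
    the integrand times [s] is the [y]-derivative of [- H * s ^ 2 * f], which vanishes at the apex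
    and leaves the base. *)
Lemma Rintegral_slab_apexB :
  \int[leb2]_(p in slab b H)
    (2 * f p + (p.1 - b) * pderiv 0 f p + (p.2 - H) * pderiv 1 f p) =
  H * \int[leb]_(t in `[0, 1]) f (t, 0).
Proof.
have [_ c0] := C1f 0; have [_ c1] := C1f 1.
pose s (y : R) := 1 - y / H.
apply: etrans; first apply: (@Rintegral_slab_flux (b, H) (cst 0)
  (fun q => - H * (s q.2 * s q.2 * f (duffy q)))
  (cst 0) (fun q => - H * (s q.2 * s q.2) *
     ((b - q.1) / H * pderiv 0 f (duffy q) + pderiv 1 f (duffy q)) +
     2 * s q.2 * f (duffy q))).
- exact: cst_continuous.
- apply: continuous_add; apply: continuous_mul.
  + by apply: continuous_mul; [exact: cst_continuous|exact: continuous_mul].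
  + apply: continuous_add; last exact: cf.
    apply: continuous_mul; last exact: cf.
    apply: continuous_mul; last exact: cst_continuous.
    by apply: continuous_add; [exact: cst_continuous|apply: continuous_opp; exact: continuous_fst].
  + by apply: continuous_mul; [exact: cst_continuous|exact: cs].
  + by apply: cf; exact: C1_continuous.
- by move=> t y; exact: is_derive_cst.
- move=> t y /=; apply: is_derive_eq (is_derive_scale (- H) (is_derive_mul
    (is_derive_mul (is_derive_height y) (is_derive_height y)) (is_derive_duffy_snd t y))) _.
  by rewrite /s; field.
- by move=> q; rewrite /s /duffy/=; field.
under eq_Rintegral do rewrite subrr.
rewrite Rintegral_cst// mul0r add0r -RintegralZl//; last first.
  exact: (continuous_itv_integrable _ _ (continuous_row (C1_continuous C1f))).
apply: eq_Rintegral => t _; rewrite /s /= divff//.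
have -> : duffy (t, 0) = (t, 0) by rewrite /duffy/= mul0r mulr0 subr0 mul1r add0r.
by rewrite subrr !mul0r mulr0 subr0 !mul1r add0r mulNr opprK.
Qed.

(** One computation covers both vertices on the base. The primitive [y * s * f] in [y] vanishes at
    both ends, and [(t - c) * f] in [t] leaves the two slanted sides with weights [1 - c] and [c];
    taking [c] equal to 0 or 1 keeps only the side opposite to the apex. *)
Lemma Rintegral_slab_base (c : R) :
  \int[leb2]_(p in slab b H)
    (2 * f p + (p.1 - c) * pderiv 0 f p + p.2 * pderiv 1 f p) =
  \int[leb]_(y in `[0, H]) ((1 - c) * f (duffy (1, y)) + c * f (duffy (0, y))).
Proof.
have [_ c0] := C1f 0; have [_ c1] := C1f 1.
pose s (y : R) := 1 - y / H.
under eq_Rintegral do rewrite -[X in X * pderiv 1 f _]subr0.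
apply: etrans; first apply: (@Rintegral_slab_flux (c, 0)
  (fun q => (q.1 - c) * f (duffy q)) (fun q => q.2 * s q.2 * f (duffy q))
  (fun q => (q.1 - c) * (s q.2 * pderiv 0 f (duffy q)) + f (duffy q))
  (fun q => q.2 * s q.2 *
     ((b - q.1) / H * pderiv 0 f (duffy q) + pderiv 1 f (duffy q)) +
     (s q.2 - q.2 / H) * f (duffy q))).
- apply: continuous_add; last by apply: cf; exact: C1_continuous.
  apply: continuous_mul.
    by apply: continuous_add; [exact: continuous_fst|exact: cst_continuous].
  by apply: continuous_mul; [exact: cs|exact: cf].
- apply: continuous_add; apply: continuous_mul.
  + by apply: continuous_mul; [exact: continuous_snd|exact: cs].
  + apply: continuous_add; last exact: cf.
    apply: continuous_mul; last exact: cf.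
    apply: continuous_mul; last exact: cst_continuous.
    by apply: continuous_add; [exact: cst_continuous|apply: continuous_opp; exact: continuous_fst].
  + apply: continuous_add; first exact: cs.
    by apply/continuous_opp/continuous_mul; [exact: continuous_snd|exact: cst_continuous].
  + by apply: cf; exact: C1_continuous.
- move=> t y /=.
  have dt : is_derive t 1 (fun t : R => t - c) 1.
    have -> : (fun t : R => t - c) = (fun t => - c + 1 * t).
      by apply/funext => z; rewrite mul1r addrC.
    exact: is_derive_affine.
  by apply: is_derive_eq (is_derive_mul dt (is_derive_duffy_fst t y)) _; rewrite mul1r.
- move=> t y /=.
  apply: is_derive_eq (is_derive_mul
    (is_derive_mul (is_derive_id y 1) (is_derive_height y)) (is_derive_duffy_snd t y)) _.
  by rewrite /s; field.
- by move=> q; rewrite /s /duffy/=; field.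
have -> : \int[leb]_(t in `[0, 1]) (H * s H * f (duffy (t, H)) - 0 * s 0 * f (duffy (t, 0))) = 0.
  under eq_Rintegral do rewrite /s divff// subrr mulr0 !mul0r subr0.
  by rewrite Rintegral_cst// mul0r.
by rewrite addr0; apply: eq_Rintegral => y _ /=; rewrite sub0r mulNr opprK.
Qed.

Lemma Rintegral_affine (h : R -> R) (k : R) : 0 < k -> continuous h ->
  \int[leb]_(x in `[0, k]) h x = k * \int[leb]_(t in `[0, 1]) h (k * t).
Proof.
move=> k0 ch.
have chk : continuous (fun t : R => h (k * t)).
  move=> t; apply: continuous_comp; last exact: ch.
  by apply: cvgMr; exact: cvg_id.
rewrite -RintegralZl//; last exact: continuous_itv_integrable.
rewrite /Rintegral; have := integral_affine 0 k0 ch; rewrite add0r => ->.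
by congr fine; apply: eq_integral => t _; rewrite add0r.
Qed.

(** The case [c = 0] keeps the side [duffy (1, y)], which joins [(1, 0)] to [(b, H)]; it is then
    rescaled by [y = H * t]. *)
Lemma Rintegral_slab_apexO :
  \int[leb2]_(p in slab b H) (2 * f p + p.1 * pderiv 0 f p + p.2 * pderiv 1 f p) =
  H * \int[leb]_(t in `[0, 1]) f (1 - t + t * b, t * H).
Proof.
under eq_Rintegral do rewrite -[X in X * pderiv 0 f _]subr0.
rewrite Rintegral_slab_base.
under eq_Rintegral do rewrite subr0 mul1r mul0r addr0.
rewrite Rintegral_affine//; last exact: (continuous_col (cf (C1_continuous C1f))).
congr (_ * _); apply: eq_Rintegral => t _; rewrite /duffy/=; congr (f (_, _)); by field.
Qed.

Lemma Rintegral_slab_apexA :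
  \int[leb2]_(p in slab b H)
    (2 * f p + (p.1 - 1) * pderiv 0 f p + p.2 * pderiv 1 f p) =
  H * \int[leb]_(t in `[0, 1]) f (t * b, t * H).
Proof.
rewrite Rintegral_slab_base.
under eq_Rintegral do rewrite subrr mul0r mul1r add0r.
rewrite Rintegral_affine//; last exact: (continuous_col (cf (C1_continuous C1f))).
congr (_ * _); apply: eq_Rintegral => t _; rewrite /duffy/=; congr (f (_, _)); by field.
Qed.

End gauss_green.

(** * Passing to the limit in integrals under L2 convergence *)

Section L2_convergence.
Context d (T : measurableType d) {R : realType} (mu : {measure set T -> \bar R}).
Implicit Types (D : set T) (f m : T -> R).

Lemma Lfun2_mul_integrable D f m : m \_ D \in Lfun mu 2%:E -> f \_ D \in Lfun mu 2%:E ->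
  mu.-integrable setT (EFin \o ((fun x => m x * f x) \_ D)).
Proof.
move=> lm lf; have /Lfun1_integrable := Lfun2_mul_Lfun1 lm lf.
congr (mu.-integrable _ _); apply/funext => x /=; congr EFin.
by rewrite !patchE; case: ifP => //; rewrite mulr0.
Qed.

(** By the Cauchy-Schwarz inequality the integrals differ by at most the norm of [m] times that of
    [f_ n \- f]. The measure is arbitrary, so that the lemma serves both the triangle and the
    parameter interval of an edge. *)
Lemma Rintegral_mul_cvg D (m f : T -> R) (f_ : nat -> T -> R) :
  m \_ D \in Lfun mu 2%:E -> f \_ D \in Lfun mu 2%:E ->
  (forall n, f_ n \_ D \in Lfun mu 2%:E) ->
  'N[mu]_(2%:E)[EFin \o ((f_ n \- f)%R \_ D)]%E @[n --> \oo] --> 0%E ->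
  \int[mu]_(x in D) (m x * f_ n x) @[n --> \oo] --> \int[mu]_(x in D) (m x * f x).
Proof.
move=> lm lf lf_ cvg.
have lm2 : ('N[mu]_(2%:E)[EFin \o (m \_ D)] < +oo)%E.
  by move: lm; rewrite inE => /andP[_]; rewrite inE.
set c := 'N[mu]_(2%:E)[EFin \o (m \_ D)]%E in lm2.
have cfin : c \is a fin_num by rewrite ge0_fin_numE ?Lnorm_ge0.
pose a n := 'N[mu]_(2%:E)[EFin \o ((f_ n \- f)%R \_ D)]%E.
have /fine_cvg ca0 : (c * a n)%E @[n --> \oo] --> 0%E.
  by rewrite -(mule0 c); exact: cvgeZl.
have le n : `|\int[mu]_(x in D) (m x * f_ n x) - \int[mu]_(x in D) (m x * f x)| <=
    fine (c * a n)%E.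
  have lB : (f_ n \- f) \_ D \in Lfun mu 2%:E.
    have -> : (f_ n \- f) \_ D = f_ n \_ D - f \_ D.
      by apply/funext => x; rewrite -[RHS]/(_ x - _ x) !patchE; case: ifP; rewrite ?subr0.
    exact: (Lfun_addr_closed mu (lee1n 2)).2 (lf_ n) (Lfun_oppr_closed lf).
  rewrite Rintegral_mkcond (Rintegral_mkcond _ D) -RintegralB//; try exact: Lfun2_mul_integrable.
  rewrite (_ : (fun x => _) = (fun x => m x * (f_ n \- f) x) \_ D); last first.
    by apply/funext => x; rewrite !patchE; case: ifP; rewrite ?subr0//= mulrBr.
  have iB := Lfun2_mul_integrable lm lB.
  have afin : a n \is a fin_num.
    rewrite ge0_fin_numE ?Lnorm_ge0//.
    by move: lB; rewrite inE => /andP[_]; rewrite inE.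
  rewrite (le_trans (le_normr_Rintegral _ iB))// -lee_fin [leRHS]fineK ?fin_numM//.
  rewrite fineK; last first.
    rewrite ge0_fin_numE; last by apply: integral_ge0 => x _; rewrite lee_fin.
    by have /integrableP[_] := iB.
  rewrite (_ : (\int[mu]_x _)%E = 'N[mu]_(1%:E)[EFin \o ((m \_ D) \* ((f_ n \- f)%R \_ D))%R]%E).
    apply: hoelder => //; last by rewrite [RHS]splitr !div1r.
    - by move: lm; rewrite inE => /andP[]; rewrite inE.
    - by move: lB; rewrite inE => /andP[]; rewrite inE.
  rewrite Lnorm1; apply: eq_integral => x _ /=; congr (`|_|%:E).
  by rewrite !patchE; case: ifP; rewrite ?mulr0.
apply/subr_cvg0/norm_cvg0P.
apply: (@squeeze_cvgr _ _ _ _ (cst 0) (fun n => fine (c * a n)%E)) => //.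
- by near=> n; rewrite normr_ge0 le.
- exact: cvg_cst.
Unshelve. all: end_near. Qed.

End L2_convergence.

(** * Extending the flux identity to H1 functions through their traces *)

Section traces.
Context {R : realType}.
Local Notation mR := (measurableTypeR R).
Local Notation leb := (@lebesgue_measure R).
Local Notation leb2 := (leb \x leb)%E.
Local Notation plane := (R * R)%type.

(** Membership in [H1] makes the set of candidates nonempty, so [xget] returns an actual weak
    derivative. *)
Lemma wderivP (Om : set plane) (v : plane -> R) i : H1 Om v ->
  L2 Om (wderiv Om i v) /\ is_weak_deriv Om i v (wderiv Om i v).
Proof. by move=> [_ /(_ i)] /xgetPex; exact. Qed.

Lemma smooth_C1 (f : plane -> R) : smooth f -> C1 f.
Proof. by move=> /(_ 1); exact: class_C1. Qed.

Lemma continuous_itv_L2 (h : R -> R) (a b : R) : continuous h ->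
  h \_ `[a, b] \in Lfun leb 2%:E.
Proof.
move=> ch; apply: Lfun2_sqr_integrable.
  apply/(measurable_restrictT _ _).1 => //.
  by apply: measurable_funTS; exact: continuous_measurable_fun.
have -> : (fun x => ((h \_ `[a, b]) x ^+ 2)%:E) = (EFin \o (fun x => h x ^+ 2)) \_ `[a, b].
  by apply/funext => p; rewrite !patchE; case: ifP => //= _; rewrite expr0n.
apply/(integrable_mkcond _ _).1 => //.
apply: continuous_itv_integrable => x.
by rewrite (_ : (fun _ => _) = h \* h)//; apply: cvgM; exact: ch.
Qed.

Lemma continuous_edge_point (e : plane * plane) (f : plane -> R) : continuous f ->
  continuous (fun t : R => f (edge_point e t)).
Proof.
move=> cf.
have cid : continuous (fun t : R => t) by move=> ?; exact: cvg_id.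
have c1t : continuous (fun t : R => 1 - t).
  by apply: continuous_add; [exact: cst_continuous|exact: continuous_opp].
apply: (continuous_pair (u := fun t : R => (1 - t) * e.1.1 + t * e.2.1)
   (v := fun t : R => (1 - t) * e.1.2 + t * e.2.2)) => //.
  by apply: continuous_add; apply: continuous_mul => //; exact: cst_continuous.
by apply: continuous_add; apply: continuous_mul => //; exact: cst_continuous.
Qed.

(** The identity holds for each smooth [phi n] of the sequence defining the trace. The area terms
    converge since the weights are continuous on a bounded set, and the edge term converges to [k]
    times the integral of the trace, which is 0. *)
Lemma trace_flux (Om : set (mR * mR)) (k : R) (P : plane) (e : plane * plane) (v : plane -> R) :
  bounded_measurable Om ->
  (forall f, C1 f ->
    \int[leb2]_(p in Om)
      (2 * f p + (p.1 - P.1) * pderiv 0 f p + (p.2 - P.2) * pderiv 1 f p) =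
    k * \int[leb]_(t in `[0, 1]) f (edge_point e t)) ->
  0 < edge_length e -> H1 Om v -> edge_mean_zero Om e v ->
  \int[leb2]_(p in Om) (2 * v p) +
  \int[leb2]_(p in Om) ((p.1 - P.1) * wderiv Om 0 v p) +
  \int[leb2]_(p in Om) ((p.2 - P.2) * wderiv Om 1 v p) = 0.
Proof.
move=> bOm flux e0 H1v [g [[Lg [phi [sphi c cd ce]]] ge]].
have [mOm _] := bOm.
have L2v : L2 Om v by case: H1v.
have C1phi n : C1 (phi n) by exact: smooth_C1.
have cphi n := C1_continuous (C1phi n).
have cm1 : continuous (fun p : plane => p.1 - P.1).
  by apply: continuous_add; [exact: continuous_fst|exact: cst_continuous].
have cm2 : continuous (fun p : plane => p.2 - P.2).
  by apply: continuous_add; [exact: continuous_snd|exact: cst_continuous].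
have I1 : \int[leb2]_(p in Om) (2 * phi n p) @[n --> \oo] --> \int[leb2]_(p in Om) (2 * v p).
  apply: (@Rintegral_mul_cvg _ _ _ leb2 Om (cst 2) v phi) => //.
  - exact: (continuous_L2 bOm (@cst_continuous _ _ _)).
  - by move=> n; exact: continuous_L2.
have I2 i (m : plane -> R) : continuous m ->
    \int[leb2]_(p in Om) (m p * pderiv i (phi n) p) @[n --> \oo] -->
    \int[leb2]_(p in Om) (m p * wderiv Om i v p).
  move=> cm; apply: (@Rintegral_mul_cvg _ _ _ leb2 Om m _ (fun n => pderiv i (phi n))) => //.
  - exact: (continuous_L2 bOm).
  - by have [] := wderivP i H1v.
  - by move=> n; apply: continuous_L2 => //; have [] := C1phi n i.
  - exact: cd.
(* The factor [cst 1] only brings the edge integral into the form of a product with a fixed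
   weight. *)
have I3 : \int[leb]_(t in `[0, 1]) (cst 1 t * phi n (edge_point e t)) @[n --> \oo] -->
    \int[leb]_(t in `[0, 1]) (cst 1 t * g (edge_point e t)).
  apply: (@Rintegral_mul_cvg _ _ _ leb `[0, 1]%classic (cst 1) (g \o edge_point e)
     (fun n => phi n \o edge_point e)) => //.
  - exact: (continuous_itv_L2 _ _ (@cst_continuous _ _ _)).
  - by move=> n; apply: continuous_itv_L2; exact: continuous_edge_point.
  (* The edge norm is the norm on the parameter interval times the root of the length, which can be
     divided out because the length is positive. *)
  - have l0 : Num.sqrt (edge_length e) != 0 by rewrite gt_eqF// sqrtr_gt0.
    have := @cvgeZl _ _ _ _ _ (Num.sqrt (edge_length e))^-1%:E erefl ce.
    rewrite mule0 => h.
    have E : (fun n => ((Num.sqrt (edge_length e))^-1%:E * edge_L2norm e (phi n \- g)%R)%E) =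
        (fun n => 'N[leb]_(2%:E)[EFin \o
        (((phi n \o edge_point e) \- (g \o edge_point e))%R \_ `[0%R, 1%R])]%E).
      by apply/funext => n; rewrite /edge_L2norm muleA -EFinM mulVf// mul1e.
    by move: h; rewrite E.
have J : \int[leb2]_(p in Om) (2 * phi n p) +
    \int[leb2]_(p in Om) ((p.1 - P.1) * pderiv 0 (phi n) p) +
    \int[leb2]_(p in Om) ((p.2 - P.2) * pderiv 1 (phi n) p) @[n --> \oo] -->
  \int[leb2]_(p in Om) (2 * v p) +
  \int[leb2]_(p in Om) ((p.1 - P.1) * wderiv Om 0 v p) +
  \int[leb2]_(p in Om) ((p.2 - P.2) * wderiv Om 1 v p).
  apply: cvgD; last exact: (I2 1 _ cm2).
  by apply: cvgD; [exact: I1|exact: (I2 0 _ cm1)].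
have g0 : \int[leb]_(t in `[0, 1]) (cst 1 t * g (edge_point e t)) = 0.
  under eq_Rintegral do rewrite mul1r.
  move: ge; rewrite /edge_integral => /eqP; rewrite mulf_eq0 => /orP[|/eqP//].
  by rewrite gt_eqF.
have /(@cvgMr _ _ _ _ _ k) := I3; rewrite g0 mulr0 => J3.
(* Both sides are now limits of sequences that agree term by term, by [flux]. *)
rewrite -(cvg_lim (@Rhausdorff R) J) -[RHS](cvg_lim (@Rhausdorff R) J3).
congr (lim (_ @ \oo)); apply/funext => n; apply/esym.
under eq_Rintegral do rewrite mul1r.
have iC (m h : plane -> R) : continuous m -> continuous h ->
    leb2.-integrable Om (EFin \o (fun p => m p * h p)).
  by move=> cm ch; apply: continuous_bounded_integrable => //; exact: continuous_mul.
rewrite -flux// RintegralD//; first rewrite RintegralD//.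
- by apply: iC => //; exact: cst_continuous.
- by apply: iC => //; have [] := C1phi n 0.
- apply: continuous_bounded_integrable => //.
  apply: continuous_add; apply: continuous_mul => //; first exact: cst_continuous.
  by have [] := C1phi n 0.
- by apply: iC => //; have [] := C1phi n 1.
Qed.

End traces.

(** * Vanishing mean of the gradient from the three flux identities *)

Section mean_of_gradient.
Context {R : realType}.
Local Notation mR := (measurableTypeR R).
Local Notation leb := (@lebesgue_measure R).
Local Notation leb2 := (leb \x leb)%E.
Local Notation plane := (R * R)%type.

(** Isolates the dependence on the vertex: its coordinate [c] only multiplies the mean of [a]. *)
Lemma Rintegral_mulB (D : set (mR * mR)) (m a : plane -> R) (c : R) :
  bounded_measurable D -> continuous m -> L2 D a ->
  \int[leb2]_(p in D) ((m p - c) * a p) =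
  \int[leb2]_(p in D) (m p * a p) - c * \int[leb2]_(p in D) a p.
Proof.
move=> bD cm La; have [mD _] := bD.
have iD (h : plane -> R) : continuous h -> leb2.-integrable D (EFin \o (fun p => h p * a p)).
  move=> ch; apply/(integrable_mkcond _ _).2 => //; rewrite restrict_EFin.
  by apply: Lfun2_mul_integrable => //; exact: (continuous_L2 bD).
have ia : leb2.-integrable D (EFin \o a).
  have := iD _ (@cst_continuous _ _ (1 : R)).
  by congr (_.-integrable _ _); apply/funext => p /=; rewrite mul1r.
rewrite -RintegralZl// -RintegralB//; first last.
- exact: (iD _ (@cst_continuous _ _ c)).
- exact: iD.
by apply: eq_Rintegral => p _; rewrite mulrBl.
Qed.

Variables (b H : R).
Hypothesis H_gt0 : 0 < H.

(* M P - M Q is the pairing of Q - P with the vector of the means of a0 and a1. *)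
Lemma mean_grad0 (v a0 a1 : plane -> R) :
  let M P := \int[leb2]_(p in slab b H) (2 * v p) +
    \int[leb2]_(p in slab b H) ((p.1 - P.1) * a0 p) +
    \int[leb2]_(p in slab b H) ((p.2 - P.2) * a1 p) in
  L2 (slab b H) a0 -> L2 (slab b H) a1 ->
  M (0, 0) = 0 -> M (1, 0) = 0 -> M (b, H) = 0 ->
  \int[leb2]_(p in slab b H) a0 p = 0 /\ \int[leb2]_(p in slab b H) a1 p = 0.
Proof.
have bD := bounded_measurable_slab b H_gt0.
move=> M La0 La1; rewrite /M /=.
rewrite !(Rintegral_mulB _ bD (@continuous_fst R) La0).
rewrite !(Rintegral_mulB _ bD (@continuous_snd R) La1).
move: (\int[leb2]_(p in slab b H) (2 * v p)) => J.
move: (\int[leb2]_(p in slab b H) (p.1 * a0 p)) => X.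
move: (\int[leb2]_(p in slab b H) (p.2 * a1 p)) => Y.
move: (\int[leb2]_(p in slab b H) a0 p) (\int[leb2]_(p in slab b H) a1 p) => A0 A1.
move=> hO hA hB.
have A00 : A0 = 0 by lra.
split=> //; apply/eqP; move: hB; rewrite A00 => hB.
have : H * A1 == 0 by apply/eqP; lra.
by rewrite mulf_eq0 gt_eqF.
Qed.

(** This lemma and the next two put the apex identities in the shape of the hypothesis of
    [trace_flux], with each vertex paired with the opposite edge. *)
Lemma flux_vertexO f : C1 f ->
  \int[leb2]_(p in slab b H) (2 * f p + (p.1 - 0) * pderiv 0 f p + (p.2 - 0) * pderiv 1 f p) =
  H * \int[leb]_(t in `[0, 1]) f (edge_point ((1, 0), (b, H)) t).
Proof.
move=> C1f; under eq_Rintegral do rewrite !subr0.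
rewrite Rintegral_slab_apexO//; congr (_ * _); apply: eq_Rintegral => t _.
rewrite -[edge_point _ _]/((1 - t) * 1 + t * b, (1 - t) * 0 + t * H).
by rewrite mulr1 mulr0 add0r.
Qed.

Lemma flux_vertexA f : C1 f ->
  \int[leb2]_(p in slab b H) (2 * f p + (p.1 - 1) * pderiv 0 f p + (p.2 - 0) * pderiv 1 f p) =
  H * \int[leb]_(t in `[0, 1]) f (edge_point ((0, 0), (b, H)) t).
Proof.
move=> C1f; under eq_Rintegral do rewrite [X in X * pderiv 1 f _]subr0.
rewrite Rintegral_slab_apexA//; congr (_ * _); apply: eq_Rintegral => t _.
rewrite -[edge_point _ _]/((1 - t) * 0 + t * b, (1 - t) * 0 + t * H).
by rewrite mulr0 !add0r.
Qed.

Lemma flux_vertexB f : C1 f ->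
  \int[leb2]_(p in slab b H) (2 * f p + (p.1 - b) * pderiv 0 f p + (p.2 - H) * pderiv 1 f p) =
  H * \int[leb]_(t in `[0, 1]) f (edge_point ((0, 0), (1, 0)) t).
Proof.
move=> C1f; rewrite Rintegral_slab_apexB//; congr (_ * _); apply: eq_Rintegral => t _.
rewrite -[edge_point _ _]/((1 - t) * 0 + t * 1, (1 - t) * 0 + t * 0).
by rewrite !mulr0 !add0r mulr1.
Qed.

End mean_of_gradient.

(** * The triangle of the statement *)

Section triangle.
Context {R : realType}.
Local Notation leb := (@lebesgue_measure R).
Local Notation leb2 := (leb \x leb)%E.
Variables (alpha theta : R).
Hypotheses (alpha_gt0 : 0 < alpha) (alpha_le1 : alpha <= 1)
  (theta_ge : acos (alpha / 2) <= theta) (theta_lt : theta < pi).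
Local Notation b := (alpha * cos theta).
Local Notation H := (alpha * sin theta).

(** Since [alpha / 2 < 1], the lower bound on [theta] is positive, so [theta] lies strictly between
    0 and [pi]. *)
Lemma height_gt0 : 0 < H.
Proof.
rewrite mulr_gt0// sin_gt0_pi// theta_lt andbT (lt_le_trans _ theta_ge)//.
apply: acos_gt0; rewrite (le_trans (lerN10 _)) ?divr_ge0 ?ltW//=.
by rewrite ltr_pdivrMr// mul1r (le_lt_trans alpha_le1)// ltr1n.
Qed.

Lemma triangleE : triangle alpha theta = slab b H.
Proof.
have H0 := height_gt0.
apply/seteqP; split=> [x [a [d [c [a0 d0 c0 abc xE]]]]|[x y] [/= y0 yH lx xr]].
  have {xE}-> : x = (d + c * b, c * H).
    by rewrite xE -[LHS]/(a * 0 + d * 1 + c * b, a * 0 + d * 0 + c * H) !mulr0 !add0r mulr1.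
  rewrite /slab/= mulfK ?gt_eqF// mulr_gt0//.
  split=> //; [|lra|lra].
  by rewrite gtr_pMl//; lra.
(* Barycentric coordinates: the height determines the weight [y / H] of B, the horizontal distance
   to the side OB the weight of A, and O takes the rest. *)
exists (1 - (x - b * (y / H)) - y / H), (x - b * (y / H)), (y / H).
split; [lra|lra|by rewrite divr_gt0|lra|].
rewrite -[RHS]/(_ * 0 + (x - b * (y / H)) * 1 + y / H * b,
  _ * 0 + (x - b * (y / H)) * 0 + y / H * H).
by rewrite !mulr0 !add0r mulr1 divfK ?gt_eqF// mulrC subrK.
Qed.

Lemma V4_wderiv_mean0 v i : V4 alpha theta v ->
  \int[leb2]_(x in triangle alpha theta) wderiv (triangle alpha theta) i v x = 0.
Proof.
have H0 := height_gt0; have bD := bounded_measurable_slab b H0.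
move=> [[H1v _]]; rewrite triangleE in H1v * => Ev.
have [La0 _] := wderivP 0 H1v; have [La1 _] := wderivP 1 H1v.
have [A0 A1] : \int[leb2]_(p in slab b H) wderiv (slab b H) 0 v p = 0 /\
   \int[leb2]_(p in slab b H) wderiv (slab b H) 1 v p = 0.
  apply: (@mean_grad0 _ b H H0 v) => //.
  - apply: (@trace_flux R _ H (0, 0) ((1, 0), (b, H)) v bD (flux_vertexO b H0)) => //.
      by rewrite sqrtr_gt0/= ltr_wpDl ?sqr_ge0// exprn_gt0// subr0.
    by apply: Ev; right.
  - apply: (@trace_flux R _ H (1, 0) ((0, 0), (b, H)) v bD (flux_vertexA b H0)) => //.
      by rewrite sqrtr_gt0/= ltr_wpDl ?sqr_ge0// exprn_gt0// subr0.
    by apply: Ev; left; right.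
  - apply: (@trace_flux R _ H (b, H) ((0, 0), (1, 0)) v bD (flux_vertexB b H0)) => //.
      by rewrite sqrtr_gt0/= ltr_wpDr ?sqr_ge0// exprn_gt0// subr0.
    by apply: Ev; left; left.
have [->|->] : i = 0 \/ i = 1.
  by case: i => -[|[|//]] i2; [left|right]; exact/val_inj.
- exact: A0.
- exact: A1.
Qed.

End triangle.

(** * Quotients in the extended reals *)

Section ereal_quotients.
Context {R : realType}.
Local Open Scope ereal_scope.
Implicit Types x d s : \bar R.

(** If [d = 0], a positive [x] would give the quotient [+oo], against the finiteness of [s]; hence
    [x = 0]. *)
Lemma lee_quotient_mul x d s : 0 <= x -> 0 <= d -> d < +oo -> s < +oo ->
  x / d <= s -> x <= s * d.
Proof.
move=> x0; case: d => [d| |]//; rewrite lee_fin le_eqVlt => /predU1P[<- _|d0 _] soo.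
  rewrite inve0 mule0; move: x0; rewrite le_eqVlt => /predU1P[<-//|x0].
  by rewrite gt0_muley// leye_eq => /eqP sy; rewrite sy in soo.
by rewrite inver gt_eqF// lee_pdivrMr.
Qed.

(** If [d = 0] the hypothesis forces [x = 0], and [0 / 0] evaluates to 0 here. *)
Lemma lee_mul_quotient x d s : 0 <= x -> 0 <= d -> d < +oo -> 0 <= s ->
  x <= s * d -> x / d <= s.
Proof.
move=> x0; case: d => [d| |]//; rewrite lee_fin le_eqVlt => /predU1P[<- _|d0 _] s0.
  rewrite mule0 => xle0; have -> : x = 0 by apply/eqP; rewrite eq_le xle0.
  by rewrite mul0e.
by rewrite inver gt_eqF// lee_pdivrMr.
Qed.

Lemma quotient_gt0 x d : 0 < x -> 0 <= d -> d < +oo -> 0 < x / d.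
Proof.
move=> x0; case: d => [d| |]//; rewrite lee_fin le_eqVlt => /predU1P[<- _|d0 _].
  by rewrite inve0 gt0_muley.
by rewrite inver gt_eqF// mule_gt0// lte_fin invr_gt0.
Qed.

Lemma sqrte_lty x : x < +oo -> sqrte x < +oo.
Proof. by case: x => [r||]//= _; rewrite ltry. Qed.

End ereal_quotients.

(** * Norms, seminorms and suprema of ratios *)

Section seminorms.
Context {R : realType}.
Local Notation mR := (measurableTypeR R).
Local Notation leb := (@lebesgue_measure R).
Local Notation leb2 := (leb \x leb)%E.
Local Notation plane := (R * R)%type.
Implicit Types (Om : set plane) (v : plane -> R).

Lemma L2norm_ge0 Om v : (0 <= L2norm Om v)%E.
Proof. exact: Lnorm_ge0. Qed.

Lemma L2norm_lty Om v : L2 Om v -> (L2norm Om v < +oo)%E.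
Proof. by rewrite /L2 inE => /andP[_]; rewrite inE. Qed.

Lemma L2norm_eq0 Om v : L2 Om v -> L2norm Om v = 0%E -> ae_eq leb2 Om v (cst 0).
Proof.
rewrite /L2 inE => /andP[+ _]; rewrite inE => mv N0.
have := Lnorm_eq0_eq0 _ _ N0; move=> /(_ _ _)[] //.
  exact/measurable_EFinP.
move=> N [mN N00 sN]; exists N; split=> // x /= nx; apply: sN => /= h; apply: nx => Ox.
by move: (h I) => /=; rewrite patchE mem_set// => -[].
Qed.

Lemma ae_eq0_L2norm Om v : L2 Om v -> ae_eq leb2 Om v (cst 0) -> L2norm Om v = 0%E.
Proof.
rewrite /L2 inE => /andP[+ _]; rewrite inE => mv v0.
have : (L2norm Om v `^ 2 = 0)%E.
  rewrite Lnorm2_sqr (ae_eq_integral (cst 0)) ?integral0//.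
    by apply/measurable_EFinP; exact: measurable_funX.
  move: v0; apply: filterS => p vp _ /=; rewrite patchE; case: ifP => [|_].
    by rewrite inE => /vp ->; rewrite expr0n.
  by rewrite expr0n.
by move=> /poweR_eq0_eq0; apply; exact: L2norm_ge0.
Qed.

Lemma seminorm1_ge0 Om v : (0 <= seminorm1 Om v)%E.
Proof. exact: sqrte_ge0. Qed.

Lemma seminorm1_lty Om v : H1 Om v -> (seminorm1 Om v < +oo)%E.
Proof.
move=> H1v; apply: sqrte_lty; rewrite lte_sum_pinfty// => i _.
have [L2i _] := wderivP i H1v.
by rewrite expe2 lte_mul_pinfty ?L2norm_ge0 ?L2norm_lty// ge0_fin_numE ?L2norm_ge0 ?L2norm_lty.
Qed.

Lemma seminorm2_ge0 Om v : (0 <= seminorm2 Om v)%E.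
Proof. exact: sqrte_ge0. Qed.

Lemma seminorm1_sqr Om v :
  (seminorm1 Om v ^+ 2 = \sum_(i < 2) L2norm Om (wderiv Om i v) ^+ 2)%E.
Proof. by rewrite sqr_sqrte// sume_ge0// => i _; rewrite expe_ge0// L2norm_ge0. Qed.

(** Grouping the second derivatives by the derivative taken first exhibits the seminorms of the
    functions [wderiv Om j v], to which the bound by [C0] applies. *)
Lemma seminorm2E Om v :
  seminorm2 Om v = sqrte (\sum_(j < 2) seminorm1 Om (wderiv Om j v) ^+ 2)%E.
Proof.
rewrite /seminorm2 exchange_big; congr sqrte; apply: eq_bigr => j _.
by rewrite seminorm1_sqr.
Qed.

Lemma seminorm2_lty Om v : H2 Om v -> (seminorm2 Om v < +oo)%E.
Proof.
move=> [_ H1d]; rewrite seminorm2E; apply: sqrte_lty; rewrite lte_sum_pinfty// => i _.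
by rewrite expe2 lte_mul_pinfty ?seminorm1_ge0 ?seminorm1_lty//
  ge0_fin_numE ?seminorm1_ge0 ?seminorm1_lty.
Qed.

Lemma sup_ratio_ubound Om V N D v : V v -> ~ ae_eq leb2 Om v (cst 0) ->
  (N v / D v <= sup_ratio Om V N D)%E.
Proof. by move=> Vv v0; apply: ereal_sup_ubound; exists v. Qed.

Lemma le_sup_ratio Om V V' N D : V `<=` V' ->
  (sup_ratio Om V N D <= sup_ratio Om V' N D)%E.
Proof.
move=> VV'; apply: ereal_sup_le => _ [v [Vv v0] <-].
by exists v => //; split=> //; exact: VV'.
Qed.

(** Functions that are zero almost everywhere do not enter the supremum; for them the left-hand side
    is 0 and the sign of the supremum suffices. *)
Lemma L2norm_le_sup_ratio Om V v : V v -> H1 Om v ->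
  (0 <= sup_ratio Om V (L2norm Om) (seminorm1 Om) < +oo)%E ->
  (L2norm Om v <= sup_ratio Om V (L2norm Om) (seminorm1 Om) * seminorm1 Om v)%E.
Proof.
move=> Vv H1v /andP[s0 soo].
have [v0|v0] := pselect (ae_eq leb2 Om v (cst 0)).
  by rewrite ae_eq0_L2norm ?mule_ge0 ?seminorm1_ge0//; case: H1v.
apply: lee_quotient_mul => //; [exact: L2norm_ge0|exact: seminorm1_ge0| |].
  exact: seminorm1_lty.
exact: sup_ratio_ubound.
Qed.

End seminorms.

(** * A nonzero function of mean zero in H1 *)

Section nonzero_mean0.
Context {R : realType}.
Local Notation mR := (measurableTypeR R).
Local Notation leb := (@lebesgue_measure R).
Local Notation leb2 := (leb \x leb)%E.
Local Notation plane := (R * R)%type.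
Variables (b H : R).
Hypothesis H_gt0 : 0 < H.
Local Notation T := (slab b H).
Let bT : bounded_measurable T := bounded_measurable_slab b H_gt0.

(** The classical counterpart of the argument for [V4]: with zero edge integrals the three flux
    identities feed [mean_grad0]. It stands in for integration by parts against test functions. *)
Lemma Rintegral_pderiv0 (f : plane -> R) i : C1 f ->
  (forall t, f (edge_point ((1, 0), (b, H)) t) = 0) ->
  (forall t, f (edge_point ((0, 0), (b, H)) t) = 0) ->
  (forall t, f (edge_point ((0, 0), (1, 0)) t) = 0) ->
  \int[leb2]_(p in T) pderiv i f p = 0.
Proof.
move=> C1f fO fA fB.
have cf := C1_continuous C1f.
have cd j : continuous (pderiv j f) by have [] := C1f j.
have split3 (P : plane) :
    \int[leb2]_(p in T) (2 * f p + (p.1 - P.1) * pderiv 0 f p + (p.2 - P.2) * pderiv 1 f p) = 0 ->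
    \int[leb2]_(p in T) (2 * f p) + \int[leb2]_(p in T) ((p.1 - P.1) * pderiv 0 f p) +
    \int[leb2]_(p in T) ((p.2 - P.2) * pderiv 1 f p) = 0.
  have [mT _] := bT.
  have c1 : continuous (fun p : plane => (p.1 - P.1) * pderiv 0 f p).
    apply: continuous_mul => //.
    by apply: continuous_add; [exact: continuous_fst|exact: cst_continuous].
  have c2 : continuous (fun p : plane => (p.2 - P.2) * pderiv 1 f p).
    apply: continuous_mul => //.
    by apply: continuous_add; [exact: continuous_snd|exact: cst_continuous].
  have c3 : continuous (fun p : plane => 2 * f p).
    by apply: continuous_mul => //; exact: cst_continuous.
  have c4 := continuous_add c3 c1.
  have I := continuous_bounded_integrable bT.
  by rewrite (RintegralD mT (I _ c4) (I _ c2)) (RintegralD mT (I _ c3) (I _ c1)).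
have edge0 e : (forall t, f (edge_point e t) = 0) ->
    H * \int[leb]_(t in `[0, 1]) f (edge_point e t) = 0.
  move=> fe; under eq_Rintegral do rewrite fe.
  by rewrite Rintegral_cst// mul0r mulr0.
have [A0 A1] : \int[leb2]_(p in T) pderiv 0 f p = 0 /\ \int[leb2]_(p in T) pderiv 1 f p = 0.
  apply: (@mean_grad0 _ b H H_gt0 f).
  - exact: (continuous_L2 bT).
  - exact: (continuous_L2 bT).
  - by apply: (split3 (0, 0)); rewrite flux_vertexO// edge0.
  - by apply: (split3 (1, 0)); rewrite flux_vertexA// edge0.
  - by apply: (split3 (b, H)); rewrite flux_vertexB// edge0.
have [->|->] : i = 0 \/ i = 1.
  by case: i => -[|[|//]] i2; [left|right]; exact/val_inj.
- exact: A0.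
- exact: A1.
Qed.

(** The product of [p.1 - c] and a test function vanishes off the open triangle, so its partial
    derivatives have integral 0; the product rule splits this into the required identity. *)
Lemma is_weak_deriv_fst (c : R) i :
  is_weak_deriv T i (fun p => p.1 - c) (cst (i == 0)%:R).
Proof.
move=> phi [sphi _ supp].
have C1phi := smooth_C1 sphi.
have phi0 p : ~ T p -> phi p = 0.
  move=> nTp; apply/eqP; apply: contrapT => /negP p0.
  by apply: nTp; apply: supp; exact: subset_closure.
have C1v := C1_fst c.
have e0 e : (forall t, ~ T (edge_point e t)) ->
    forall t, ((edge_point e t).1 - c) * phi (edge_point e t) = 0.
  by move=> nT t; rewrite phi0// mulr0.
have J : \int[leb2]_(p in T) pderiv i (fun x => (x.1 - c) * phi x) p = 0.
  have H0 : H != 0 by rewrite gt_eqF.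
  apply: Rintegral_pderiv0; first exact: C1M.
  (* On the line through an edge, one strict inequality of [slab] becomes an equality, for every
     real [t]. *)
  - apply: (e0 ((1, 0), (b, H))) => t.
    rewrite -[edge_point _ _]/((1 - t) * 1 + t * b, (1 - t) * 0 + t * H).
    rewrite mulr1 mulr0 add0r => -[_ _ _ /=]; rewrite mulfK// (mulrC b) addrC.
    by rewrite ltxx.
  - apply: (e0 ((0, 0), (b, H))) => t.
    rewrite -[edge_point _ _]/((1 - t) * 0 + t * b, (1 - t) * 0 + t * H).
    rewrite mulr0 !add0r => -[_ _ /= + _]; rewrite mulfK// (mulrC b).
    by rewrite ltxx.
  - apply: (e0 ((0, 0), (1, 0))) => t.
    rewrite -[edge_point _ _]/((1 - t) * 0 + t * 1, (1 - t) * 0 + t * 0).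
    rewrite !mulr0 addr0 => -[/= + _ _ _].
    by rewrite ltxx.
have cphi := C1_continuous C1phi; have cv := C1_continuous C1v.
have cdphi : continuous (pderiv i phi) by have [] := C1phi i.
have [mT _] := bT; have I := continuous_bounded_integrable bT.
have c1 : continuous (fun p => (p.1 - c) * pderiv i phi p) by exact: continuous_mul.
have c2 : continuous (fun p : plane => cst (i == 0)%:R p * phi p).
  by apply: continuous_mul => //; exact: cst_continuous.
move/eqP: J; under eq_Rintegral => p _.
  rewrite pderivM//.
  have -> : pderiv i (fun x : plane => x.1 - c) p = (i == 0)%:R.
    by have [_] := is_derive_fst i c p.
  rewrite (mulrC (phi p)).
  over.
by rewrite (RintegralD mT (I _ c1) (I _ c2)) addr_eq0 => /eqP.
Qed.

(** The flux identity for the constant function 1 reads: twice the area equals [H]. *)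
Lemma Rintegral_slab1 : \int[leb2]_(p in T) 1 = H / 2.
Proof.
have C1c : C1 (cst 1 : plane -> R).
  move=> i; split=> [x|]; first exact: derivable_cst.
  rewrite (_ : pderiv i _ = cst 0); first exact: cst_continuous.
  by apply/funext => x; exact: derive_cst.
have p0 i p : pderiv i (cst 1 : plane -> R) p = 0 by exact: derive_cst.
have := flux_vertexO b H_gt0 C1c.
under eq_Rintegral do rewrite !p0 !mulr0 !addr0.
have [mT _] := bT.
rewrite !Rintegral_cst//= lebesgue_measure_itv/= .
rewrite (Rintegral_cst _ mT (2 * 1)) lte_fin ltr01/= oppr0 addr0 => E.
lra.
Qed.

Definition mean_fst : R := \int[leb2]_(p in T) p.1 / \int[leb2]_(p in T) 1.

Lemma slab_mean0 : \int[leb2]_(p in T) (p.1 - mean_fst) = 0.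
Proof.
have L1 : L2 T (cst 1) by apply: (continuous_L2 bT); exact: cst_continuous.
have := Rintegral_mulB mean_fst bT (@continuous_fst R) L1.
under eq_Rintegral do rewrite mulr1.
under [X in _ = X - _ -> _]eq_Rintegral do rewrite mulr1.
move=> ->; rewrite divfK ?subrr// Rintegral_slab1.
by rewrite mulf_neq0// gt_eqF.
Qed.

(** Otherwise the triangle would be covered by a null set and the vertical line [p.1 = c],
    contradicting its area [H / 2]. *)
Lemma slab_nonzero (c : R) : ~ ae_eq leb2 T (fun p => p.1 - c) (cst 0).
Proof.
have [mT _] := bT.
move=> [N [mN N0 sN]].
have : leb2 T = 0%E.
  apply/eqP; rewrite -measure_le0 -(_ : leb2 (N `|` ([set c] `*` setT)) = 0%E).
    rewrite le_measure ?inE//.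
      by apply: measurableU => //; apply: measurableX => //; exact: measurable_set1.
    move=> p Tp; have [pc|pc] := eqVneq p.1 c; [right; split|left] => //.
    apply: sN => /= /(_ Tp) /eqP; rewrite subr_eq0; exact/negP.
  have ml : measurable ([set c] `*` setT : set (mR * mR)).
    by apply: measurableX => //; exact: measurable_set1.
  have l0 : leb2 ([set c] `*` setT) = 0%E.
    rewrite (product_measure1E leb leb (measurable_set1 c) measurableT).
    by rewrite [X in (X * _)%E](lebesgue_measure_set1 c) mul0e.
  apply/eqP; rewrite -measure_le0.
  have NL : (leb2 N + leb2 ([set c] `*` setT) <= 0)%E.
    by rewrite l0 adde0 (_ : leb2 N = 0%E).
  exact: (le_trans (measureU2 leb2 mN ml) NL).
move=> T0; have : H / 2 = 1 * fine (leb2 T).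
  exact: (etrans (esym Rintegral_slab1) (Rintegral_cst _ mT 1)).
by rewrite T0 mulr0 => /eqP; apply/negP; rewrite mulf_neq0// gt_eqF.
Qed.

End nonzero_mean0.

(** * Comparison of the constants *)

Section constants.
Context {R : realType}.
Local Notation leb := (@lebesgue_measure R).
Local Notation leb2 := (leb \x leb)%E.
Variables (alpha theta : R).
Hypotheses (alpha_gt0 : 0 < alpha) (alpha_le1 : alpha <= 1)
  (theta_ge : acos (alpha / 2) <= theta) (theta_lt : theta < pi).
Local Notation T := (triangle alpha theta).
Local Notation C0 := (C0 alpha theta).
Local Notation C123 := (C123 alpha theta).

Lemma sup_ratio_gt0 (V : set (R * R -> R)) v : V v -> H1 T v ->
  ~ ae_eq leb2 T v (cst 0) -> (0 < sup_ratio T V (L2norm T) (seminorm1 T))%E.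
Proof.
move=> Vv H1v v0; apply: lt_le_trans (sup_ratio_ubound _ _ Vv v0).
apply: quotient_gt0; [|exact: seminorm1_ge0|exact: seminorm1_lty].
rewrite lt0e L2norm_ge0 andbT; apply/eqP => N0; apply: v0.
by apply: L2norm_eq0 => //; case: H1v.
Qed.

(** Nonnegativity allows multiplying inequalities by [C0]; strict positivity makes [C0 * C123]
    infinite when [C123] is. *)
Lemma C0_gt0 : (0 < C0)%E.
Proof.
have H0 := height_gt0 alpha_gt0 alpha_le1 theta_ge theta_lt.
set b := alpha * cos theta; set H := alpha * sin theta in H0.
have bT := bounded_measurable_slab b H0.
have TE : T = slab b H by exact: triangleE.
pose v (p : R * R) := p.1 - mean_fst b H.
have H1v : H1 T v.
  rewrite TE; split.
    by apply: (continuous_L2 bT); exact: C1_continuous (C1_fst _).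
  move=> i; exists (cst (i == 0)%:R); split; last exact: is_weak_deriv_fst.
  by apply: (continuous_L2 bT); exact: cst_continuous.
apply: (@sup_ratio_gt0 _ v) => //.
  by split=> //; rewrite TE; exact: slab_mean0.
by rewrite TE; exact: slab_nonzero.
Qed.

Lemma C0_ge0 : (0 <= C0)%E. Proof. exact/ltW/C0_gt0. Qed.

Lemma V4_wderiv_V0 v i : V4 alpha theta v -> V0 alpha theta (wderiv T i v).
Proof.
move=> V4v; split; first by case: V4v => -[_ H1d] _.
exact: V4_wderiv_mean0.
Qed.

Lemma V4_V123 v : V4 alpha theta v -> V123 alpha theta v.
Proof. by move=> [[H1v _] Ev]. Qed.

Lemma seminorm1_le_C0 v : V4 alpha theta v -> (C0 < +oo)%E ->
  (seminorm1 T v <= C0 * seminorm2 T v)%E.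
Proof.
move=> V4v C0oo; have c0 := C0_ge0.
(* The right-hand side is written as the root of its square, so that squares can be compared one
   partial derivative at a time. *)
rewrite -[leRHS]gee0_abs ?mule_ge0 ?seminorm2_ge0// -sqrte_sqr.
rewrite lee_sqrt; last by rewrite expe_ge0// mule_ge0 ?seminorm2_ge0.
rewrite !expe2 muleACA -!expe2 seminorm2E sqr_sqrte; last first.
  by rewrite sume_ge0// => i _; rewrite expe_ge0// seminorm1_ge0.
rewrite ge0_sume_distrr; last by move=> i _; rewrite expe_ge0// seminorm1_ge0.
apply: lee_sum => i _.
rewrite [leRHS](_ : _ = (C0 * seminorm1 T (wderiv T i v)) ^+ 2)%E; last first.
  by rewrite !expe2 muleACA.
rewrite lee_sqr ?mule_ge0 ?L2norm_ge0 ?seminorm1_ge0//.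
have Vi := V4_wderiv_V0 i V4v.
by apply: L2norm_le_sup_ratio => //; [case: Vi|apply/andP].
Qed.

Lemma C4_le_C0 : (C4 alpha theta <= C0)%E.
Proof.
apply: ge_ereal_sup => _ [v [V4v v0] <-].
have [C0oo|] := ltP C0 +oo%E; last by rewrite leye_eq => /eqP ->; exact: leey.
apply: lee_mul_quotient; [exact: seminorm1_ge0|exact: seminorm2_ge0| | |].
- by apply: seminorm2_lty; case: V4v.
- exact: C0_ge0.
- exact: seminorm1_le_C0.
Qed.

Lemma C5_le_C0_C123 : (C5 alpha theta <= C0 * C123)%E.
Proof.
apply: ge_ereal_sup => _ [v [V4v v0] <-].
have V123v := V4_V123 V4v; have [[H1v H1d] _] := V4v.
(* The function [v] itself witnesses this, so an infinite factor makes the product [+oo] and the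
   bound trivial. *)
have C123_gt0 : (0 < C123)%E by exact: sup_ratio_gt0 V123v H1v v0.
have [C123oo|] := ltP C123 +oo%E; last first.
  by rewrite leye_eq => /eqP ->; rewrite gt0_muley ?leey// C0_gt0.
have [C0oo|] := ltP C0 +oo%E; last first.
  by rewrite leye_eq => /eqP ->; rewrite gt0_mulye ?leey.
apply: lee_mul_quotient; [exact: L2norm_ge0|exact: seminorm2_ge0| | |].
- by apply: seminorm2_lty; case: V4v.
- by rewrite mule_ge0 ?C0_ge0 ?ltW.
(* The two estimates are chained through the first-order seminorm: [C123] bounds the norm by it, and
   [C0] bounds it by the second-order one. *)
- apply: (@le_trans _ _ (C123 * seminorm1 T v)%E).
    by apply: L2norm_le_sup_ratio => //; rewrite ltW.
  rewrite (muleC C0) -muleA; apply: lee_wpmul2l; first exact: ltW.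
  exact: seminorm1_le_C0.
Qed.

End constants.

Unset Implicit Arguments.

Theorem mainTheorem3 (R : realType) (alpha theta : R)
    (alpha_gt0 : 0 < alpha) (alpha_le1 : alpha <= 1)
    (theta_ge : acos (alpha / 2) <= theta) (theta_lt : theta < pi) :
  (C4 alpha theta <= C0 alpha theta)%E /\
  (C5 alpha theta <= C0 alpha theta * C123 alpha theta)%E /\
  (C0 alpha theta * C123 alpha theta <= C0 alpha theta * C12 alpha theta)%E.
Proof.
split; first exact: C4_le_C0.
split; first exact: C5_le_C0_C123.
apply: lee_wpmul2l; first exact: C0_ge0.
(* Dropping the condition on [edge3] enlarges the space, hence the supremum. *)
apply: le_sup_ratio => v [H1v Ev]; split=> // e Je.
by apply: Ev; left.
Qed.
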